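(* For each fixed $n\in\mathbb{N}_0$, the function $\pi\mapsto V(n,\pi)$ is concave on $(0,1)$.
   Context: $\mathbb{N}_0=\{0,1,2,\dots\}$ and $a\wedge b=\min\{a,b\}$. Let $\nu$ be a nonzero $\sigma$-finite measure on $\mathbb{R}$. Define $B(u)=\log\int_{\mathbb{R}}e^{ux}\,\nu(dx)$, $N=\{u\in\mathbb{R}:\int_{\mathbb{R}}e^{ux}\,\nu(dx)<\infty\}$ (an interval), $N^\circ$ the interior of $N$, and for $u\in N$ let $p_u(x)=\exp\{ux-B(u)\}$. Let $\mu$ (the prior distribution) be a probability measure concentrated on $N^\circ$, with support $S$. Fix $\theta_0\in\mathbb{R}$ and set $S^+=S\cap(\theta_0,\infty)$, $S^-=S\cap(-\infty,\theta_0]$. Assume $0<\mu(S^+)<1$, and that $\int_S e^{uy-nB(u)}\,\mu(du)<\infty$ for all $n\in\mathbb{N}_0$ and $y\in\mathbb{R}$. For $n\in\mathbb{N}_0$, $y\in\mathbb{R}$ put $$q(n,y)=\frac{\int_{S^+}e^{uy-nB(u)}\mu(du)}{\int_{S}e^{uy-nB(u)}\mu(du)},\qquad \mu_{n,y}(du)=\frac{e^{uy-nB(u)}\mu(du)}{\int_{S}e^{vy-nB(v)}\mu(dv)}.$$ For each $n$, $y\mapsto q(n,y)$ is an increasing bijection $\mathbb{R}\to(0,1)$; for $\pi\in(0,1)$, $y(n,\pi)$ denotes the unique value with $q(n,y(n,\pi))=\pi$. For $n\in\mathbb{N}_0$ and $\pi\in(0,1)$, $\mathbb{P}_{n,\pi}$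 (with expectation $\mathbb{E}_{n,\pi}$) is the probability measure under which a random variable $\Theta$ has distribution $\mu_{n,y(n,\pi)}$ and, conditional on $\Theta=u$, the observations $X_{n+1},X_{n+2},\dots$ are independent with law $p_u(x)\,\nu(dx)$. Under $\mathbb{P}_{n,\pi}$ the posterior probability process is $\Pi_{n+k}=q\bigl(n+k,\,y(n,\pi)+X_{n+1}+\dots+X_{n+k}\bigr)$, $k\ge 0$, so that $\Pi_n=\pi$ and $\Pi_{n+k}=\mathbb{P}_{n,\pi}(\Theta>\theta_0\mid X_{n+1},\dots,X_{n+k})$. Let $c>0$ be a constant. The value function $V:\mathbb{N}_0\times(0,1)\to[0,\infty)$ is $$V(n,\pi)=\inf_{\tau}\mathbb{E}_{n,\pi}\bigl[\Pi_{n+\tau}\wedge(1-\Pi_{n+\tau})+c\tau\bigr],$$ where the infimum is over $\mathbb{N}_0$-valued stopping times $\tau$ of the filtration $(\sigma(X_{n+1},\dots,X_{n+k}))_{k\ge 0}$. *)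

(* Defs.v *)
From HB Require Import structures.
From mathcomp Require Import all_boot all_order all_algebra.
From mathcomp Require Import all_classical all_reals all_analysis.

Set Implicit Arguments.
Unset Strict Implicit.
Unset Printing Implicit Defensive.

Import Order.TTheory GRing.Theory Num.Theory.
Import numFieldNormedType.Exports.

Local Open Scope classical_set_scope.
Local Open Scope convex_scope.
Local Open Scope ring_scope.

(* Mirror image of convex_function. *)
Definition concave_function (R : numFieldType) (E : lmodType R)
    (E' := convex_lmodType E) (D : set E') (f : E' -> R^o) :=
  forall t : {i01 R},
    {in D &, forall x y : E', f x <| t |> f y <= f (x <| t |> y)}.

Definition msupport (R : realType) (mu : set R -> \bar R) : set R :=
  [set x | forall U : set R, open U -> U x -> (0 < mu U)%E].

(* Y i is the (i+1)-st observation, so history Y k is generated by the first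
   k observations; history Y 0 is trivial. *)
Definition history (R : realType) (d : measure_display) (T : measurableType d)
    (Y : nat -> T -> R) (k : nat) : set (set T) :=
  <<s \bigcup_(i < k) preimage_set_system setT (Y i) measurable >>.

Definition stopping_time (T : Type) (F : nat -> set (set T)) (tau : T -> nat) :=
  forall k : nat, F k [set w | (tau w <= k)%N].

(* Conditionally on Theta = u, the variables Y 0, Y 1, ... are independent with
   common law K u. *)
Definition conditionally_iid (R : realType) (d : measure_display)
    (T : measurableType d) (P : probability T R) (Theta : {RV P >-> R})
    (Y : nat -> {RV P >-> R}) (K : R -> set R -> \bar R) :=
  forall (k : nat) (A : set R) (B : nat -> set R),
    measurable A -> (forall i, measurable (B i)) ->
    P (Theta @^-1` A `&` \bigcap_(i < k) (Y i @^-1` B i)) =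
    (\int[distribution P Theta]_(u in A) \prod_(i < k) K u (B i))%E.

Section exponential_family.
Context (R : realType).
Variable nu : {measure set R -> \bar R}.

(* B(u) is only meaningful for u in Ndom; outside it takes the value
   ln 0 = 0. *)
Definition Ndom : set R :=
  [set u | (\int[nu]_x (expR (u * x))%:E < +oo)%E].

Definition B (u : R) : R := ln (fine (\int[nu]_x (expR (u * x))%:E)).

Definition p (u x : R) : R := expR (u * x - B u).

Definition obs_law (u : R) (A : set R) : \bar R :=
  (\int[nu]_(x in A) (p u x)%:E)%E.

Variable mu : probability R R.
Variable theta0 : R.

Definition Splus : set R := msupport mu `&` `]theta0, +oo[.

Definition weight (n : nat) (y u : R) : R := expR (u * y - n%:R * B u).

Definition weight_int (n : nat) (y : R) (A : set R) : \bar R :=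
  (\int[mu]_(u in A) (weight n y u)%:E)%E.

Definition q (n : nat) (y : R) : R :=
  fine (weight_int n y Splus) / fine (weight_int n y (msupport mu)).

Definition mu_post (n : nat) (y : R) (A : set R) : \bar R :=
  (weight_int n y A * ((fine (weight_int n y (msupport mu)))^-1)%:E)%E.

Definition y_of (n : nat) (pi0 : R) : R := xget 0 [set y | q n y = pi0].

Section bayes.
Context (d : measure_display) (Omega : measurableType d).
Variables (Theta : {mfun Omega >-> R}) (X : nat -> {mfun Omega >-> R}).

(* P is the law P_(n,pi); X j is the observation X_j, j >= 1 (X 0 is unused). *)
Definition bayes_model (n : nat) (pi0 : R) (P : probability Omega R) :=
  (forall A : set R, measurable A ->
     distribution P Theta A = mu_post n (y_of n pi0) A) /\
  @conditionally_iid R d Omega P Theta (fun i => X (n + i).+1) obs_law.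

Definition Pi (n : nat) (pi0 : R) (k : nat) (w : Omega) : R :=
  q (n + k) (y_of n pi0 + \sum_(i < k) X (n + i).+1 w).

Definition risk (c : R) (n : nat) (pi0 : R) (P : probability Omega R)
    (tau : Omega -> nat) : \bar R :=
  ('E_P[fun w => (Num.min (Pi n pi0 (tau w) w) (1 - Pi n pi0 (tau w) w)
                 + c * (tau w)%:R)%R])%E.

(* The infimum lies in [0, 1/2] (take tau = 0), so fine loses nothing. *)
Definition V (c : R) (P : nat -> R -> probability Omega R) (n : nat) (pi0 : R) :
    R :=
  fine (ereal_inf [set risk c n pi0 (P n pi0) tau | tau in
    [set tau | stopping_time (history (fun i => X (n + i).+1)) tau]]).

End bayes.
End exponential_family.

(* Main.v *)
(* Let [U] and [L] be the unnormalized posterior masses of the two hypotheses, as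
   functions of the score [y], and multiply every risk by [U + L]. Concavity in
   the posterior probability [pi = U / (U + L)] then says that [v s2] dominates
   [l1 * v s1 + l3 * v s3] whenever [(U s2, L s2)] is the corresponding
   combination of the pairs at [s1] and [s3]. By dynamic programming the value is
   the infimum of the values [v_N] of the problems truncated after [N]
   observations, and each [v_N] has this property by induction. Indeed [v_N] is
   the minimum of [U], [L] and (cost + expected [v_(N-1)] at the next score).
   Replace [v_(N-1)] by its supporting lines [a * U + b * L], where [a] decreases
   and [b] increases with the score. By the monotone likelihood ratio, their
   conditional means given [Theta = u] decrease, resp. increase, in [u]. The
   density of the mixture of the posteriors at [s1] and [s3] with respect to the
   posterior at [s2] is a convex function of [u] whose mean is 1 on each
   hypothesis; hence on each side of [theta0] it crosses 1 only once, and the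
   mixture has a smaller mean of [a] above [theta0] and of [b] below it. *)
Require Import Defs.
From HB Require Import structures.
From mathcomp Require Import all_boot all_order all_algebra.
From mathcomp Require Import all_classical all_reals all_analysis.
From mathcomp Require Import measurable_realfun ring lra.
Import Order.TTheory GRing.Theory Num.Theory.
Import numFieldNormedType.Exports.
Local Open Scope classical_set_scope.
Local Open Scope ring_scope.

(** * Measures with a density *)

(** An infimum of functions affine in the prior is concave, but this does not apply here: the
    posterior with upper mass [pi] is not affine in [pi], because the law of [Theta] inside each
    hypothesis also moves with the score. The mixture of the posteriors at [s1] and [s3] gives each
    hypothesis the same mass as the posterior at [s2], yet differs from it; comparing the two is the
    core of the proof. Masses are left unnormalized because integrating them over the next
    observation against [nu] gives back the current masses: the normalization of the predictive
    density cancels and the recursion becomes linear. Optimal rules are needed only for the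
    truncated problems. An arbitrary rule cut off after [N] observations costs at most the
    probability of [tau > N] more, and this tends to 0 because [tau] is finite everywhere. The model
    prescribes only joint probabilities of product events; the conditional law of the next
    observation given the history has to be derived from them. *)

Section density.
Context {d} {T : measurableType d} {R : realType}.
Variables (m : {measure set T -> \bar R}) (g : T -> R).
Hypotheses (mg : measurable_fun setT g) (g0 : forall x, 0 <= g x).

Definition density (A : set T) : \bar R := (\int[m]_(x in A) (g x)%:E)%E.

Let density0 : density set0 = 0%E.
Proof. by rewrite /density integral_set0. Qed.

Let density_ge0 A : (0 <= density A)%E.
Proof. by apply: integral_ge0 => x _; rewrite lee_fin. Qed.

Let density_sigma_additive : semi_sigma_additive density.
Proof.
move=> F mF tF mUF; rewrite /density ge0_integral_bigcup//; last 2 first.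
- exact/measurable_EFinP/measurable_funTS.
- by move=> x _; rewrite lee_fin.
by apply: is_cvg_ereal_nneg_natsum_cond => n _ _; exact: density_ge0.
Qed.

HB.instance Definition _ := isMeasure.Build _ _ _ density
  density0 density_ge0 density_sigma_additive.

Definition density_measure : {measure set T -> \bar R} := density.

Import HBNNSimple.

(** Monotone convergence along simple approximations of [f]. The measure [m'] need only agree with
    [density] on measurable sets, so that the law of [Theta], which the model describes set by set,
    is covered. *)
Lemma integral_density (m' : {measure set T -> \bar R}) (f : T -> \bar R) :
  (forall A, measurable A -> m' A = density A) ->
  measurable_fun setT f -> (forall x, (0 <= f x)%E) ->
  (\int[m']_x f x = \int[m]_x (f x * (g x)%:E))%E.
Proof.
move=> m'E mf f0.
pose h := nnsfun_approx measurableT mf.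
have fE x : (f x = limn (fun n => (h n x)%:E))%E.
  by apply/esym/cvg_lim => //; exact: cvg_nnsfun_approx.
have ndh x : {homo (fun n => (h n x)%:E) : a b / (a <= b)%N >-> (a <= b)%E}.
  by move=> a b ab; rewrite lee_fin; exact/lefP/nd_nnsfun_approx.
have fgE x : (f x * (g x)%:E = limn (fun n => (h n x)%:E * (g x)%:E))%E.
  by apply/esym/cvg_lim => //; apply: cvgeZr => //; exact: cvg_nnsfun_approx.
rewrite (eq_integral (fun x => limn (fun n => (h n x)%:E))); last by move=> x _; rewrite fE.
rewrite monotone_convergence//; last 2 first.
- by move=> n; exact/measurable_EFinP.
- by move=> n x _; rewrite lee_fin.
rewrite [RHS](eq_integral (fun x => limn (fun n => (h n x)%:E * (g x)%:E)%E)); last first.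
  by move=> x _; rewrite fgE.
rewrite [RHS]monotone_convergence//; last 3 first.
- by move=> n; apply: emeasurable_funM; exact/measurable_EFinP.
- by move=> n x _; rewrite mule_ge0// lee_fin.
- by move=> x _ a b ab; rewrite lee_wpmul2r ?lee_fin//; exact/lefP/nd_nnsfun_approx.
congr (limn _); apply/funext => n.
under eq_integral do rewrite fimfunE -fsumEFin//.
rewrite ge0_integral_fsum//; last 2 first.
  - by move=> y; exact/measurable_EFinP/measurable_funM.
  - by move=> y x _; rewrite nnfun_muleindic_ge0.
under [RHS]eq_integral => x _.
  rewrite fimfunE -fsumEFin// ge0_mule_fsuml; last first.
    by move=> y; exact: nnfun_muleindic_ge0.
  over.
rewrite ge0_integral_fsum//; last 2 first.
  - move=> y; apply: emeasurable_funM.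
      exact/measurable_EFinP/measurable_funM.
    exact/measurable_EFinP.
  - by move=> y x _; rewrite mule_ge0 ?nnfun_muleindic_ge0// lee_fin.
apply: eq_fsbigr => r _.
rewrite integralZl_indic_nnsfun// integral_indic// setIT m'E// /density.
have [r0|r0] := ltP r 0.
  rewrite preimage_nnfun0// integral_set0 mule0 integral0_eq// => x _.
  by rewrite indicE in_set0 mulr0 mul0e.
rewrite -ge0_integralZl_EFin//; last 2 first.
- by move=> x _; rewrite lee_fin.
- exact/measurable_EFinP/measurable_funTS.
rewrite integral_mkcond; apply: eq_integral => x _.
rewrite patchE indicE; case: ifPn => _; first by rewrite mulr1.
by rewrite mulr0 mul0e.
Qed.

End density.

(** Both sides are measures in [A]: the restriction of [P] to [E] and the measure with density
    [phi]. They are finite and agree on a pi-system containing the whole space. *)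
Lemma integral_g_sigma_algebra {d} {T : measurableType d} {R : realType}
    (P : probability T R) (E : set T) (phi : T -> R)
    (G : set (set T)) :
  measurable E -> measurable_fun setT phi -> (forall x, 0 <= phi x) ->
  G `<=` measurable -> setI_closed G -> G setT ->
  (forall A, G A -> P (A `&` E) = \int[P]_(x in A) (phi x)%:E)%E ->
  (forall A, <<s G >> A -> P (A `&` E) = \int[P]_(x in A) (phi x)%:E)%E.
Proof.
move=> mE mphi phi0 Gm GI GT PG A GA.
rewrite -[LHS]/(mrestr P mE A) -[RHS]/(density P phi A).
apply: (@g_sigma_algebra_measure_unique _ _ _ G Gm (fun=> setT)) GA => //.
- by rewrite bigcup_const//; exists 0%N.
- by move=> k; rewrite /= /mrestr setTI (le_lt_trans (probability_le1 P mE))// ltry.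
Qed.

Lemma measure_prod_unique {d1 d2} {T1 : measurableType d1} {T2 : measurableType d2}
    {R : realType} (m1 m2 : {measure set (T1 * T2) -> \bar R}) :
  (m1 setT < +oo)%E ->
  (forall A B, measurable A -> measurable B -> m1 (A `*` B) = m2 (A `*` B)) ->
  forall E, measurable E -> m1 E = m2 E.
Proof.
move=> m1oo m12 E mE.
pose C : set (set (T1 * T2)) :=
  [set C | exists A, measurable A /\ exists B, measurable B /\ C = A `*` B].
have CI : setI_closed C.
  move=> /= _ _ [X1 [mX1 [X2 [mX2 ->]]]] [Y1 [mY1 [Y2 [mY2 ->]]]].
  rewrite -setXI; exists (X1 `&` Y1); split; first exact: measurableI.
  by exists (X2 `&` Y2); split => //; exact: measurableI.
apply: (measure_unique C (fun=> setT)) => //.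
- rewrite measurable_prod_measurableType //; congr (<<s _ >>).
  rewrite predeqE => E'; split => [[A mA [B mB <-]]|[A [mA [B [mB ->]]]]].
    by exists A; split => //; exists B.
  by exists A => //; exists B.
- by move=> _; exists setT; split => //; exists setT; rewrite setXTT.
- by rewrite bigcup_const//; exists 0%N.
- by move=> _ [A [mA [B [mB ->]]]]; exact: m12.
Qed.

(** * Concave functions and supporting lines *)

(** Chords to the right of [p] have slopes at most those of chords to its left, so the supremum of
    the former is the slope of a supporting line. *)
Lemma concave_supergradient {R : realType} (f : R -> R) :
  (forall t x y, 0 <= t <= 1 -> 0 < x < 1 -> 0 < y < 1 ->
     t * f x + (1 - t) * f y <= f (t * x + (1 - t) * y)) ->
  forall p, 0 < p < 1 -> exists k, forall x, 0 < x < 1 ->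
    f x <= f p + k * (x - p).
Proof.
move=> fc p /andP[p0 p1].
have slopes y x : 0 < y -> y < p -> p < x -> x < 1 ->
    (f x - f p) / (x - p) <= (f p - f y) / (p - y).
  move=> y0 yp px x1.
  have xy : 0 < x - y by lra.
  have := fc ((x - p) / (x - y)) y x; rewrite y0 x1 /=.
  have -> : (x - p) / (x - y) * y + (1 - (x - p) / (x - y)) * x = p.
    by field; rewrite gt_eqF.
  have -> : 1 - (x - p) / (x - y) = (p - y) / (x - y) by field; rewrite gt_eqF.
  have t01 : 0 <= (x - p) / (x - y) <= 1.
    by rewrite divr_ge0 ?ler_pdivrMr//=; lra.
  move=> /(_ t01) H.
  have {H} : (x - p) * f y + (p - y) * f x <= (x - y) * f p.
    have := H; rewrite -(ler_pM2l xy) => H'.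
    apply: le_trans (H' _ _); [|lra|lra].
    by rewrite le_eqVlt; apply/orP; left; apply/eqP; field; rewrite gt_eqF.
  rewrite ler_pdivrMr ?subr_gt0// mulrAC ler_pdivlMr ?subr_gt0//; lra.
pose S := [set (f x - f p) / (x - p) | x in [set x | p < x < 1]].
have S0 : S !=set0.
  by exists ((f ((p + 1) / 2) - f p) / ((p + 1) / 2 - p)), ((p + 1) / 2) => //=; lra.
have Sub y : 0 < y -> y < p -> ubound S ((f p - f y) / (p - y)).
  by move=> y0 yp _ [x /= /andP[px x1] <-]; exact: slopes.
exists (sup S) => x /andP[x0 x1].
have [xp|px|->] := ltgtP x p; last by rewrite subrr mulr0 addr0.
- have : sup S <= (f p - f x) / (p - x) by apply: ge_sup => //; exact: Sub.
  rewrite ler_pdivlMr ?subr_gt0//; lra.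
- have : (f x - f p) / (x - p) <= sup S.
    apply: ub_le_sup; last by exists x => //=; rewrite px.
    by exists ((f p - f (p / 2)) / (p - p / 2)); apply: Sub; lra.
  rewrite ler_pdivrMr ?subr_gt0//; lra.
Qed.

(** * Integral inequalities for functions that cross once *)

Section crossing.
Context {d} {T : measurableType d} {R : realType} (m : {measure set T -> \bar R}).
Variables (A : set T) (mA : measurable A) (f g : T -> R).
Hypotheses (mf : measurable_fun A f) (mg : measurable_fun A g).
Hypotheses (f0 : forall u, A u -> 0 <= f u) (g0 : forall u, A u -> 0 <= g u).
Hypothesis fgE : (\int[m]_(u in A) (f u)%:E = \int[m]_(u in A) (g u)%:E)%E.
Hypothesis gfin : (\int[m]_(u in A) (g u)%:E < +oo)%E.

(** If [f] exceeded [g] throughout [A], the positive function [f - g] would have integral 0 and [A]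
    would be null. *)
Lemma eq_integral_exists_le : m A != 0%E -> exists2 u, A u & f u <= g u.
Proof.
move=> mA0; apply: contrapT => nex.
have gf u : A u -> g u < f u.
  by move=> Au; rewrite ltNge; apply/negP => fg; apply: nex; exists u.
have mfg : measurable_fun A (fun u => (f u - g u)%:E).
  by apply/measurable_EFinP; exact: measurable_funB.
have I0 : (\int[m]_(u in A) (f u - g u)%:E = 0)%E.
  have : (\int[m]_(u in A) ((f u - g u)%:E + (g u)%:E) = \int[m]_(u in A) (g u)%:E)%E.
    by rewrite -fgE; apply: eq_integral => u _; rewrite -EFinD subrK.
  rewrite ge0_integralD//; last 2 first.
  - by move=> u Au; rewrite lee_fin subr_ge0 ltW// gf.
  - exact/measurable_EFinP.
  have gf' : (\int[m]_(u in A) (g u)%:E)%E \is a fin_num.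
    by rewrite ge0_fin_numE// integral_ge0// => u Au; rewrite lee_fin g0.
  by move=> H; rewrite -[LHS](addeK _ gf') H subee.
have : (\int[m]_(u in A) `|(f u - g u)%:E| = 0)%E.
  rewrite -I0; apply: eq_integral => u /[!inE] Au.
  by rewrite gee0_abs// lee_fin subr_ge0 ltW// gf.
move/(ae_eq_integral_abs m mA mfg) => [N [mN N0 sub]].
case/negP : mA0; apply/eqP/(subset_measure0 mA mN _ N0) => u Au; apply: sub => /= /(_ Au).
by move=> [] /eqP; rewrite subr_eq0 gt_eqF// gf.
Qed.

(* For a suitable constant [k], [(phi - k) * (f - g) <= 0] pointwise. *)
Lemma crossing_integral_le (phi : T -> R) :
  measurable_fun A phi -> (forall u, A u -> 0 <= phi u <= 1) ->
  (forall u v, A u -> A v -> f v <= g v -> g u < f u -> phi u <= phi v) ->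
  (\int[m]_(u in A) (phi u * f u)%:E <= \int[m]_(u in A) (phi u * g u)%:E)%E.
Proof.
move=> mphi phi01 cross.
(* This is [(phi - c) * (f - g) <= 0], with the terms moved so that only nonnegative functions get
   integrated. *)
have [c c0 cP] : exists2 c, 0 <= c &
    forall u, A u -> phi u * f u + c * g u <= phi u * g u + c * f u.
  have [[v Av fgv]|nex] := pselect (exists2 v, A v & f v <= g v).
    (* The constant is the infimum of [phi] where [f <= g]; by [cross] it bounds [phi] from above
       wherever [g < f]. *)
    pose S := [set phi v | v in [set v | A v /\ f v <= g v]].
    have S0 : lbound S 0 by move=> _ [w [Aw _] <-]; have /andP[] := phi01 _ Aw.
    exists (inf S); first by apply: lb_le_inf S0; exists (phi v), v.
    move=> u Au; rewrite -subr_ge0.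
    rewrite [leRHS](_ : _ = (phi u - inf S) * (g u - f u)); last by ring.
    have [fgu|gfu] := leP (f u) (g u).
      rewrite mulr_ge0 ?subr_ge0//; apply: ge_inf; first by exists 0.
      by exists u.
    rewrite mulr_le0// ?subr_le0 ?(ltW gfu)//.
    apply: lb_le_inf; first by exists (phi v), v.
    by move=> _ [w [Aw fgw] <-]; exact: cross.
  (* Here [f] exceeds [g] on all of [A], so any upper bound of [phi] will do. *)
  exists 1 => // u Au.
  have gf : g u <= f u.
    by have [fg|/ltW//] := leP (f u) (g u); case: nex; exists u.
  have /andP[p0 p1] := phi01 _ Au.
  rewrite -subr_ge0 [leRHS](_ : _ = (1 - phi u) * (f u - g u)); last by ring.
  by rewrite mulr_ge0// subr_ge0.
have mM (h k : T -> R) : measurable_fun A h -> measurable_fun A k ->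
    measurable_fun A (fun u => (h u * k u)%:E).
  by move=> ? ?; apply/measurable_EFinP; exact: measurable_funM.
have phi0 u : A u -> 0 <= phi u by move=> /phi01/andP[].
have : (\int[m]_(u in A) ((phi u * f u)%:E + (c * g u)%:E) <=
        \int[m]_(u in A) ((phi u * g u)%:E + (c * f u)%:E))%E.
  apply: ge0_le_integral => //.
  - by move=> u Au; rewrite adde_ge0// lee_fin mulr_ge0 ?phi0 ?f0 ?g0.
  - by apply: emeasurable_funD; apply: mM.
  - by apply: emeasurable_funD; apply: mM.
rewrite !ge0_integralD//;
  do ?[by apply: mM|by move=> u Au; rewrite lee_fin mulr_ge0 ?phi0 ?f0 ?g0].
under [X in (_ + X <= _)%E]eq_integral do rewrite EFinM.
under [X in (_ <= _ + X)%E]eq_integral do rewrite EFinM.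
rewrite !ge0_integralZl_EFin//;
  do ?[exact/measurable_EFinP|by move=> u Au; rewrite lee_fin ?f0 ?g0].
rewrite fgE leeD2rE// fin_numM// ge0_fin_numE// integral_ge0//.
Qed.

End crossing.

(** * The support of a probability measure *)

Lemma msupport_closed {R : realType} (mu : probability R R) : closed (msupport mu).
Proof.
rewrite -[msupport mu]setCK; apply: open_closedC; rewrite openE => x /= /existsNP[U].
move=> /not_implyP[oU] /not_implyP[Ux] muU.
rewrite /interior; apply: filterS (open_nbhs_nbhs (conj oU Ux)) => y Uy /=.
by move=> /(_ U oU Uy).
Qed.

(** The line is second countable: the complement of the support is covered by the null intervals
    with rational endpoints. They are enumerated by [unpickle], every other code giving the empty
    set. *)
Lemma msupport_full {R : realType} (mu : probability R R) : mu (~` msupport mu) = 0%E.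
Proof.
pose F (k : nat) : set R := if unpickle k is Some (a, b) then
  (let J := [set` `](ratr a : R), (ratr b : R)[%R] in
   if mu J == 0%E then J else set0) else set0.
have mF k : measurable (F k).
  by rewrite /F; case: unpickle => // -[a b]; case: ifP.
have F0 k : mu (F k) = 0%E.
  rewrite /F; case: unpickle => [[a b]|]; last by rewrite measure0.
  by case: ifPn => [/eqP//|_]; rewrite measure0.
have FE a b : F (pickle (a, b)) = (let J := [set` `](ratr a : R), (ratr b : R)[%R] in
    if mu J == 0%E then J else set0).
  by rewrite /F pickleK.
have sub : ~` msupport mu `<=` \bigcup_k F k.
  move=> x /= /existsNP[U] /not_implyP[oU] /not_implyP[Ux] muU.
  have mU : measurable U by exact: open_measurable.
  have {}muU : mu U = 0%E.
    by apply/eqP; rewrite eq_le measure_ge0 andbT leNgt; apply/negP.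
  have [e /= e0 eU] := open_nbhs_nbhs (conj oU Ux).
  have /rat_in_itvoo[a] : x - e < x by lra.
  have /rat_in_itvoo[b] : x < x + e by lra.
  rewrite !in_itv /= => /andP[xb be] /andP[ea ax].
  exists (pickle (a, b)); [exact: I|rewrite FE /=].
  have -> : mu [set` `](ratr a : R), (ratr b : R)[%R] = 0%E.
    apply: (subset_measure0 _ mU _ muU) => // y /=; rewrite in_itv/= => /andP[ay yb].
    by apply: eU; rewrite /ball /= ltr_distlC; lra.
  by rewrite eqxx /= in_itv /= ax xb.
have mC : measurable (~` msupport mu).
  by apply: open_measurable; apply: closed_openC; exact: msupport_closed.
apply: (subset_measure0 mC _ sub); first exact: bigcupT_measurable.
apply/eqP; rewrite eq_le measure_ge0 andbT.
apply: le_trans (measure_sigma_subadditive mu mF _ (@subset_refl _ _)) _.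
  exact: bigcupT_measurable.
by rewrite eseries0// => k _ _; exact: F0.
Qed.


(** * Concavity relative to a pair of masses *)

Lemma affine_ge0_at0 {R : realType} (A k : R) :
  (forall x, 0 < x < 1 -> 0 <= A + k * x) -> 0 <= A.
Proof.
move=> H; rewrite leNgt; apply/negP => A0.
(* As [d] exceeds both [- A] and the absolute value of [k], the point [- A / (2 * d)] lies in (0,
   1), and the affine function is at most [A / 2 < 0] there. *)
pose d := - A + `|k| + 1.
have k0 : 0 <= `|k| by [].
have kk : k <= `|k| by exact: ler_norm.
have d0 : 0 < d by rewrite /d; lra.
have x0 : 0 < - A / (2 * d) by rewrite divr_gt0 ?oppr_gt0// mulr_gt0.
have xd : - A / (2 * d) * d = - A / 2 by field; rewrite gt_eqF.
have x1 : - A / (2 * d) < 1 by rewrite ltr_pdivrMr ?mulr_gt0// /d; lra.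
have /H : 0 < - A / (2 * d) < 1 by rewrite x0.
have : k * (- A / (2 * d)) <= `|k| * (- A / (2 * d)) by rewrite ler_pM2r.
have : `|k| * (- A / (2 * d)) <= d * (- A / (2 * d)) by rewrite ler_pM2r// /d; lra.
rewrite [d * _]mulrC xd; lra.
Qed.

Lemma convex_combination_in01 {R : realType} (t x y : R) :
  0 <= t <= 1 -> 0 < x < 1 -> 0 < y < 1 -> 0 < t * x + (1 - t) * y < 1.
Proof.
move=> /andP[t0 t1] /andP[x0 x1] /andP[y0 y1].
have [->|tn0] := eqVneq t 0; first by rewrite mul0r add0r subr0 mul1r y0.
have tp : 0 < t by rewrite lt_neqAle eq_sym tn0.
apply/andP; split.
  by rewrite ltr_pwDl ?mulr_gt0// mulr_ge0 ?subr_ge0// ltW.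
have : t * x < t * 1 by rewrite ltr_pM2l.
have : (1 - t) * y <= (1 - t) * 1 by rewrite ler_wpM2l ?subr_ge0// ltW.
lra.
Qed.

Section pair_concave.
Context {R : realType} (U L : R -> R).

(* The first two conditions say that [(U s2, L s2)] lies in the cone spanned by
   [(U s1, L s1)] and [(U s3, L s3)]. *)
Definition balanced (s1 s2 s3 l1 l3 : R) := [/\ 0 <= l1, 0 <= l3,
  U s2 = l1 * U s1 + l3 * U s3 & L s2 = l1 * L s1 + l3 * L s3].

(** The case [l3 = 0], used in both directions, already forces [v / (U + L)] to depend on the score
    only through [U / (U + L)]. *)
Definition pair_concave (v : R -> R) := forall s1 s2 s3 l1 l3,
  balanced s1 s2 s3 l1 l3 -> l1 * v s1 + l3 * v s3 <= v s2.

Let T y := U y + L y.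
Let Q y := U y / T y.
Hypotheses (U0 : forall y, 0 < U y) (L0 : forall y, 0 < L y).

Let T0 y : 0 < T y. Proof. by rewrite addr_gt0. Qed.
Let Tn y : T y != 0. Proof. by rewrite gt_eqF. Qed.
Let Qb y : 0 < Q y < 1.
Proof. by rewrite divr_gt0//= ltr_pdivrMr// mul1r ltrDl. Qed.
Let upE y : U y = Q y * T y. Proof. by rewrite divfK. Qed.
Let loE y : L y = (1 - Q y) * T y.
Proof. by rewrite mulrBl -upE mul1r /T addrAC subrr add0r. Qed.

(** Multiplying [t] and [1 - t] by ratios of total masses turns a convex combination of the
    probabilities [Q] into a combination of the pairs [(U, L)]. Any right inverse [yo] of [Q]
    serves. *)
Lemma pair_concaveP (yo : R -> R) v : (forall p, 0 < p < 1 -> Q (yo p) = p) ->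
  pair_concave v -> forall t x y, 0 <= t <= 1 -> 0 < x < 1 -> 0 < y < 1 ->
  t * (v (yo x) / T (yo x)) + (1 - t) * (v (yo y) / T (yo y)) <=
  v (yo (t * x + (1 - t) * y)) / T (yo (t * x + (1 - t) * y)).
Proof.
move=> Qyo vconc t x y t01 x01 y01.
have z01 := convex_combination_in01 _ _ _ t01 x01 y01; have /andP[t0 t1] := t01.
have [z zE] : exists z, z = t * x + (1 - t) * y by exists (t * x + (1 - t) * y).
rewrite -zE in z01 *.
have := vconc (yo x) (yo z) (yo y) (t * T (yo z) / T (yo x)) ((1 - t) * T (yo z) / T (yo y)).
have -> : t * T (yo z) / T (yo x) * v (yo x) + (1 - t) * T (yo z) / T (yo y) * v (yo y) =
    (t * (v (yo x) / T (yo x)) + (1 - t) * (v (yo y) / T (yo y))) * T (yo z).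
  by field; rewrite !Tn.
rewrite -ler_pdivlMr//; apply; split.
- by rewrite !mulr_ge0 ?invr_ge0// ltW.
- by rewrite !mulr_ge0 ?invr_ge0 ?subr_ge0// ltW.
- by rewrite !upE (Qyo x)// (Qyo y)// (Qyo z)// {1}zE; field; rewrite !Tn.
- by rewrite !loE (Qyo x)// (Qyo y)// (Qyo z)// {1}zE; field; rewrite !Tn.
Qed.

Hypothesis Q_surj : forall p, 0 < p < 1 -> exists y, Q y = p.
Hypothesis Qmono : {homo Q : x y / x <= y}.

(** A supporting line of [v / T] as a function of [Q] becomes [a * U + b * L] once multiplied by
    [T]. Lying above a nonnegative function, it is nonnegative at both ends of (0, 1); the bounds by
    1 come from [v <= U] and [v <= L] at the point of contact. *)
Lemma pair_concave_supports v : pair_concave v ->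
  (forall y, 0 <= v y <= Num.min (U y) (L y)) ->
  exists a b : R -> R, [/\ {homo a : x y / x <= y >-> y <= x}, {homo b : x y / x <= y},
    (forall y, 0 <= a y <= 1 /\ 0 <= b y <= 1),
    (forall y y', v y <= a y' * U y + b y' * L y) &
    (forall y, v y = a y * U y + b y * L y)].
Proof.
move=> vconc vb.
have /choice[yo Qyo] : forall p0 : R, exists y, 0 < p0 < 1 -> Q y = p0.
  move=> p0; have [/Q_surj[y yp]|np] := pselect (0 < p0 < 1); last by exists 0.
  by exists y.
pose f pi0 := v (yo pi0) / T (yo pi0).
have vle z y : Q z = Q y -> T y / T z * v z <= v y.
  move=> zy; have := vconc z y z (T y / T z) 0; rewrite mul0r addr0; apply.
  split => //; first by rewrite divr_ge0// ltW.
    by rewrite !upE zy mul0r addr0; field.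
  by rewrite !loE zy mul0r addr0; field.
have vf y : v y = f (Q y) * T y.
  have zy : Q (yo (Q y)) = Q y by exact: Qyo.
  apply/eqP; rewrite eq_le /f; apply/andP; split.
    have := vle _ _ (esym zy); rewrite mulrAC ler_pdivrMr// => H.
    by rewrite mulrAC ler_pdivlMr// mulrC.
  by have := vle _ _ zy; rewrite [X in X <= _](_ : _ = v (yo (Q y)) / T (yo (Q y)) * T y)//; ring.
have fb p0 : 0 < p0 < 1 -> 0 <= f p0 /\ f p0 <= p0 /\ f p0 <= 1 - p0.
  move=> p01; have /andP[v0] := vb (yo p0); rewrite le_min upE loE (Qyo _ p01) => /andP[h1 h2].
  by rewrite /f divr_ge0 ?(ltW (T0 _))// !ler_pdivrMr.
have fconc := pair_concaveP yo v Qyo vconc.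
have /choice[k kP] : forall p0 : R, exists k, 0 < p0 < 1 -> forall x, 0 < x < 1 ->
    f x <= f p0 + k * (x - p0).
  move=> p0; have [p01|np] := pselect (0 < p0 < 1); last by exists 0.
  by have [k hk] := concave_supergradient f fconc p0 p01; exists k.
(* The values at 1 and at 0 of the supporting line at [p0]. *)
pose al p0 := f p0 + k p0 * (1 - p0); pose be p0 := f p0 - k p0 * p0.
have fab p0 : f p0 = al p0 * p0 + be p0 * (1 - p0) by rewrite /al /be; ring.
have fle p0 x : 0 < p0 < 1 -> 0 < x < 1 -> f x <= al p0 * x + be p0 * (1 - x).
  move=> hp hx; apply: le_trans (kP _ hp _ hx) _.
  by rewrite le_eqVlt; apply/orP; left; apply/eqP; rewrite /al /be; ring.
have be0 p0 : 0 < p0 < 1 -> 0 <= be p0.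
  move=> hp; apply: (@affine_ge0_at0 _ _ (k p0)) => x hx.
  have [fx0 _] := fb _ hx; apply: le_trans fx0 (le_trans (kP _ hp _ hx) _).
  by rewrite /be le_eqVlt; apply/orP; left; apply/eqP; ring.
have al0 p0 : 0 < p0 < 1 -> 0 <= al p0.
  move=> hp; apply: (@affine_ge0_at0 _ _ (- k p0)) => x /andP[x0 x1].
  have hx : 0 < 1 - x < 1 by rewrite subr_gt0 x1 gtrBl x0.
  have [fx0 _] := fb _ hx; apply: le_trans fx0 (le_trans (kP _ hp _ hx) _).
  by rewrite /al le_eqVlt; apply/orP; left; apply/eqP; ring.
have al1 p0 : 0 < p0 < 1 -> al p0 <= 1.
  move=> hp; have [p0_0 p0_1] := andP hp; have [_ [h _]] := fb _ hp.
  rewrite -(ler_pM2r p0_0) mul1r; apply: le_trans h; rewrite [leRHS]fab lerDl.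
  by rewrite mulr_ge0 ?be0// subr_ge0 ltW.
have be1 p0 : 0 < p0 < 1 -> be p0 <= 1.
  move=> hp; have [p0_0 p0_1] := andP hp; have [_ [_ h]] := fb _ hp.
  have q0 : 0 < 1 - p0 by rewrite subr_gt0.
  rewrite -(ler_pM2r q0) mul1r; apply: le_trans h; rewrite [leRHS]fab lerDr.
  by rewrite mulr_ge0 ?al0// ltW.
(* Each line passes below the other at its own point of contact. Adding the two inequalities shows
   that the slope [al - be] decreases; inserting this into each of them gives the two claims. *)
have mono p0 p1 : 0 < p0 < 1 -> 0 < p1 < 1 -> p0 <= p1 -> al p1 <= al p0 /\ be p0 <= be p1.
  move=> h0 h1; rewrite le_eqVlt => /predU1P[->//|p01].
  have H0 := fle _ _ h0 h1; have H1 := fle _ _ h1 h0.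
  rewrite [X in X <= _]fab in H0; rewrite [X in X <= _]fab in H1.
  have [/andP[p0_0 p0_1] /andP[p1_0 p1_1]] := (h0, h1).
  move: (al p1) (al p0) (be p0) (be p1) H0 H1 => a1 a0 b0 b1 H0 H1.
  have : (a1 - a0 - (b1 - b0)) * (p1 - p0) <= 0 by lra.
  rewrite pmulr_lle0 ?subr_gt0// => ab.
  have H2 : (a1 - a0) * 1 <= (a1 - a0) * p1 + (b1 - b0) * (1 - p1).
    have : (a1 - a0) * (1 - p1) <= (b1 - b0) * (1 - p1) by rewrite ler_wpM2r; lra.
    lra.
  have H3 : (a1 - a0) * p0 + (b1 - b0) * (1 - p0) <= (b1 - b0) * 1.
    have : (a1 - a0) * p0 <= (b1 - b0) * p0 by rewrite ler_wpM2r; lra.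
    lra.
  split; lra.
exists (al \o Q), (be \o Q); split => /=.
- by move=> x y xy; have [] := mono _ _ (Qb x) (Qb y) (Qmono _ _ xy).
- by move=> x y xy; have [] := mono _ _ (Qb x) (Qb y) (Qmono _ _ xy).
- by move=> y; rewrite al0// al1// be0// be1.
- move=> y y'; rewrite (_ : _ + _ = (al (Q y') * Q y + be (Q y') * (1 - Q y)) * T y).
    by rewrite vf ler_pM2r//; exact: fle.
  by rewrite upE loE; ring.
- by move=> y; rewrite [LHS]vf fab upE loE; ring.
Qed.

End pair_concave.


(** Both sides integrate [H] against the image of a measure with density; the two images agree on
    rectangles and the first is finite. The lemma serves to compare the law of the score and the
    next observation with a density on the product of [P] and [nu]. *)
Lemma integral_density_prod_unique {d1 d2 d3 d4} {S1 : measurableType d1} {S2 : measurableType d2}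
    {T1 : measurableType d3} {T2 : measurableType d4} {R : realType}
    (m1 : {measure set S1 -> \bar R}) (m2 : {measure set S2 -> \bar R})
    (f1 : S1 -> T1 * T2) (f2 : S2 -> T1 * T2) (g1 : S1 -> R) (g2 : S2 -> R)
    (H : T1 * T2 -> \bar R) :
  measurable_fun setT f1 -> measurable_fun setT f2 ->
  measurable_fun setT g1 -> measurable_fun setT g2 ->
  (forall x, 0 <= g1 x) -> (forall x, 0 <= g2 x) ->
  (\int[m1]_x (g1 x)%:E < +oo)%E ->
  (forall A B, measurable A -> measurable B ->
    \int[m1]_(x in f1 @^-1` (A `*` B)) (g1 x)%:E =
    \int[m2]_(x in f2 @^-1` (A `*` B)) (g2 x)%:E)%E ->
  measurable_fun setT H -> (forall x, 0 <= H x)%E ->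
  (\int[m1]_x (H (f1 x) * (g1 x)%:E) = \int[m2]_x (H (f2 x) * (g2 x)%:E))%E.
Proof.
move=> mf1 mf2 mg1 mg2 g10 g20 fin rect mH H0.
pose D1 := density_measure m1 g1 mg1 g10.
pose D2 := density_measure m2 g2 mg2 g20.
pose L1' : {measure set (T1 * T2) -> \bar R} := pushforward D1 f1.
pose L2' : {measure set (T1 * T2) -> \bar R} := pushforward D2 f2.
pose L1 := L1' mf1; pose L2 := L2' mf2.
have L12 E : measurable E -> L1 E = L2 E.
  apply: measure_prod_unique; last exact: rect.
  by rewrite /L1 /L1' /= /pushforward preimage_setT.
have Hf1 : measurable_fun setT (H \o f1) by exact: measurableT_comp.
have Hf2 : measurable_fun setT (H \o f2) by exact: measurableT_comp.
rewrite -(integral_density m1 g1 mg1 g10 D1 (H \o f1) _ Hf1) //; last by move=> x; exact: H0.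
rewrite -(integral_density m2 g2 mg2 g20 D2 (H \o f2) _ Hf2) //; last by move=> x; exact: H0.
have e1 : (\int[L1]_y H y = \int[D1]_x (H \o f1) x)%E.
  rewrite (ge0_integral_pushforward mf1 D1 measurableT mH) ?preimage_setT//.
have e2 : (\int[L2]_y H y = \int[D2]_x (H \o f2) x)%E.
  rewrite (ge0_integral_pushforward mf2 D2 measurableT mH) ?preimage_setT//.
rewrite -e1 -e2; apply: eq_measure_integral => A mA _; exact: L12.
Qed.

Lemma integral_mul_indic {d} {S : measurableType d} {R : realType} (m : {measure set S -> \bar R})
  (G : set S) (f : S -> \bar R) :
  (\int[m]_(x in G) f x = \int[m]_x (f x * (\1_G x)%:E))%E.
Proof.
rewrite integral_mkcond; apply: eq_integral => x _.
by rewrite patchE indicE; case: ifPn => _; rewrite ?mule1 ?mule0.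
Qed.

Lemma integral_eq_addr {d} {S : measurableType d} {R : realType} (m : {measure set S -> \bar R})
    (G : set S) (u v : S -> \bar R) (r : R) : measurable G ->
  measurable_fun G u -> measurable_fun G v -> (forall x, 0 <= u x)%E -> (forall x, 0 <= v x)%E ->
  0 <= r -> (\int[m]_(x in G) u x = \int[m]_(x in G) v x)%E ->
  (\int[m]_(x in G) (u x + r%:E) = \int[m]_(x in G) (v x + r%:E))%E.
Proof.
by move=> mG mu mv u0 v0 r0 uv; rewrite !ge0_integralD// uv.
Qed.


(** * Exponential families *)

Section exponential_family_facts.
Context {R : realType} (nu : {sigma_finite_measure set R -> \bar R}).
Hypothesis nu_neq0 : nu setT <> 0%E.

Lemma measurable_log_partition : measurable_fun setT (B nu).
Proof.
apply: measurableT_comp => //; apply: measurableT_comp.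
  exact: fine_measurable.
apply: (measurable_fun_fubini_tonelli_F (fun z : R * R => (expR (z.1 * z.2))%:E)).
  apply/measurable_EFinP; apply: measurableT_comp => //.
  by apply: measurable_funM; [exact: measurable_fst|exact: measurable_snd].
by move=> z; rewrite lee_fin expR_ge0.
Qed.

Lemma measurable_p2 : measurable_fun setT (fun z : R * R => p nu z.1 z.2).
Proof.
apply: measurableT_comp => //; apply: measurable_funB.
  by apply: measurable_funM; [exact: measurable_fst|exact: measurable_snd].
by apply: measurableT_comp; [exact: measurable_log_partition|exact: measurable_fst].
Qed.

Lemma measurable_p u : measurable_fun setT (p nu u).
Proof.
by apply: measurableT_comp => //; apply: measurable_funB => //; exact: measurable_funM.
Qed.

Lemma measurable_weight2 n : measurable_fun setT (fun z : R * R => weight nu n z.1 z.2).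
Proof.
apply: measurableT_comp => //; apply: measurable_funB.
  by apply: measurable_funM; [exact: measurable_snd|exact: measurable_fst].
apply: measurable_funM => //.
by apply: measurableT_comp; [exact: measurable_log_partition|exact: measurable_snd].
Qed.

Lemma measurable_weight n y : measurable_fun setT (weight nu n y).
Proof.
apply: measurableT_comp => //; apply: measurable_funB; first exact: measurable_funM.
by apply: measurable_funM => //; exact: measurable_log_partition.
Qed.

Lemma weight_gt0 n y u : 0 < weight nu n y u.
Proof. exact: expR_gt0. Qed.

(** Bayes' rule without normalization: an observation multiplies the weight by its likelihood. *)
Lemma weightS n y x u : weight nu n.+1 (y + x) u = weight nu n y u * p nu u x.
Proof. by rewrite /weight /p -expRD; congr expR; rewrite -natr1; ring. Qed.

(** Inverting [ln] requires a positive integral: were it 0, the positivity of the exponential would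
    make [nu] null. *)
Lemma Ndom_int u : Ndom nu u -> (\int[nu]_x (expR (u * x))%:E = (expR (B nu u))%:E)%E.
Proof.
move=> Nu; have fin : (\int[nu]_x (expR (u * x))%:E)%E \is a fin_num.
  by rewrite ge0_fin_numE// integral_ge0// => x _; rewrite lee_fin expR_ge0.
rewrite -[LHS]fineK// /B lnK// posrE fine_gt0// -ge0_fin_numE ?integral_ge0//.
rewrite fin andbT lt0e integral_ge0 ?andbT; last by move=> x _; rewrite lee_fin expR_ge0.
apply/eqP => I0.
have : (\int[nu]_x `|(expR (u * x))%:E| = 0)%E.
  by rewrite -I0; apply: eq_integral => x _; rewrite gee0_abs// lee_fin expR_ge0.
have mexp : measurable_fun setT (fun x => (expR (u * x))%:E).
  by apply/measurable_EFinP; apply: measurableT_comp => //; exact: measurable_funM.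
move/(ae_eq_integral_abs nu measurableT mexp) => [N [mN N0 sub]].
apply: nu_neq0; apply: (subset_measure0 _ mN _ N0) => // x _; apply: sub => /= /(_ I).
by move=> [] /eqP; rewrite gt_eqF// expR_gt0.
Qed.

Lemma p_int1 u : Ndom nu u -> (\int[nu]_x (p nu u x)%:E = 1)%E.
Proof.
move=> Nu.
under eq_integral do rewrite /p expRD mulrC EFinM.
rewrite ge0_integralZl_EFin ?expR_ge0//; last first.
  by apply/measurable_EFinP; apply: measurableT_comp => //; exact: measurable_funM.
by rewrite Ndom_int// -EFinM -expRD addNr expR0.
Qed.

(** The conditional mean of [phi] at one observation given [Theta = u], meaningful for [u] in
    [Ndom nu], where [p nu u] is a probability density. *)
Definition obs_mean (phi : R -> R) (u : R) : \bar R :=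
  (\int[nu]_x (phi x * p nu u x)%:E)%E.

Lemma obs_mean_ge0 (phi : R -> R) u : (forall x, 0 <= phi x) -> (0 <= obs_mean phi u)%E.
Proof. by move=> phi0; apply: integral_ge0 => x _; rewrite lee_fin mulr_ge0// expR_ge0. Qed.

Lemma obs_mean_le1 (phi : R -> R) u : Ndom nu u -> measurable_fun setT phi ->
  (forall x, 0 <= phi x <= 1) -> (obs_mean phi u <= 1)%E.
Proof.
move=> Nu mphi phi01; rewrite -(p_int1 _ Nu); apply: ge0_le_integral => //.
- by move=> x _; rewrite lee_fin mulr_ge0 ?expR_ge0//; have /andP[] := phi01 x.
- by apply/measurable_EFinP/measurable_funM => //; exact: measurable_p.
- by apply/measurable_EFinP; exact: measurable_p.
- by move=> x _; rewrite lee_fin ler_piMl ?expR_ge0//; have /andP[] := phi01 x.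
Qed.

Lemma measurable_obs_mean (phi : R -> R) : measurable_fun setT phi -> (forall x, 0 <= phi x) ->
  measurable_fun setT (obs_mean phi).
Proof.
move=> mphi phi0.
apply: (measurable_fun_fubini_tonelli_F (fun z : R * R => (phi z.2 * p nu z.1 z.2)%:E)).
  apply/measurable_EFinP/measurable_funM; last exact: measurable_p2.
  by apply: measurableT_comp => //; exact: measurable_snd.
by move=> z; rewrite lee_fin mulr_ge0// expR_ge0.
Qed.

(* Monotone likelihood ratio: [p u'/p u] is increasing when [u <= u']. *)
Lemma obs_mean_nonincreasing (phi : R -> R) u u' : Ndom nu u -> Ndom nu u' -> u <= u' ->
  measurable_fun setT phi -> (forall x, 0 <= phi x <= 1) ->
  {homo phi : x y / x <= y >-> y <= x} -> (obs_mean phi u' <= obs_mean phi u)%E.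
Proof.
move=> Nu Nu' uu' mphi phi01 phi_dec.
apply: (@crossing_integral_le _ _ _ nu setT measurableT _ _ (measurable_p u') (measurable_p u)).
- by move=> x _; rewrite expR_ge0.
- by move=> x _; rewrite expR_ge0.
- exact: etrans (p_int1 _ Nu') (esym (p_int1 _ Nu)).
- by rewrite (p_int1 _ Nu) ltry.
- exact: mphi.
- by move=> x _; exact: phi01.
move=> x v _ _; rewrite /p ler_expR ltr_expR => H1 H2; apply: phi_dec.
rewrite leNgt; apply/negP => xv.
have : (u' - u) * x <= (u' - u) * v by rewrite ler_wpM2l ?subr_ge0// ltW.
by move: H1 H2; clear; move: (B nu u) (B nu u') => b b'; lra.
Qed.

Lemma obs_mean_nondecreasing (phi : R -> R) u u' : Ndom nu u -> Ndom nu u' -> u <= u' ->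
  measurable_fun setT phi -> (forall x, 0 <= phi x <= 1) ->
  {homo phi : x y / x <= y} -> (obs_mean phi u <= obs_mean phi u')%E.
Proof.
move=> Nu Nu' uu' mphi phi01 phi_inc.
apply: (@crossing_integral_le _ _ _ nu setT measurableT _ _ (measurable_p u) (measurable_p u')).
- by move=> x _; rewrite expR_ge0.
- by move=> x _; rewrite expR_ge0.
- exact: etrans (p_int1 _ Nu) (esym (p_int1 _ Nu')).
- by rewrite (p_int1 _ Nu') ltry.
- exact: mphi.
- by move=> x _; exact: phi01.
move=> x v _ _; rewrite /p ler_expR ltr_expR => H1 H2; apply: phi_inc.
rewrite leNgt; apply/negP => xv.
have : (u' - u) * v <= (u' - u) * x by rewrite ler_wpM2l ?subr_ge0// ltW.
by move: H1 H2; clear; move: (B nu u) (B nu u') => b b'; lra.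
Qed.

Variable mu : probability R R.

Definition weight_mean (f : R -> \bar R) (n : nat) (y : R) : \bar R :=
  (\int[mu]_u (f u * (weight nu n y u)%:E))%E.

Lemma weight_meanE f n y :
  weight_mean f n y = (\int[mu]_u (f u * (weight nu n y u)%:E))%E.
Proof. by []. Qed.

Lemma weight_mean_ge0 (f : R -> \bar R) n y : (forall u, 0 <= f u)%E -> (0 <= weight_mean f n y)%E.
Proof.
by move=> f0; apply: integral_ge0 => u _; rewrite mule_ge0// lee_fin ltW// weight_gt0.
Qed.

Lemma measurable_weight_mean (f : R -> \bar R) n : measurable_fun setT f -> (forall u, 0 <= f u)%E ->
  measurable_fun setT (weight_mean f n).
Proof.
move=> mf f0.
apply: (measurable_fun_fubini_tonelli_F (fun z : R * R => (f z.2 * (weight nu n z.1 z.2)%:E)%E)).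
  apply: emeasurable_funM; last by apply/measurable_EFinP; exact: measurable_weight2.
  by apply: measurableT_comp => //; exact: measurable_snd.
by move=> z; rewrite mule_ge0// lee_fin ltW// weight_gt0.
Qed.

(** Tonelli's theorem and [weightS]: once the new observation is integrated out, all that remains of
    it is the conditional mean of [phi]. *)
Lemma weight_meanS (f : R -> \bar R) (phi : R -> R) n y :
  measurable_fun setT f -> (forall u, 0 <= f u)%E ->
  measurable_fun setT phi -> (forall x, 0 <= phi x) ->
  (\int[nu]_x ((phi x)%:E * weight_mean f n.+1 (y + x)) =
   weight_mean (fun u => f u * obs_mean phi u) n y)%E.
Proof.
move=> mf f0 mphi phi0.
have mw x : measurable_fun setT (fun u => (f u * (weight nu n.+1 (y + x) u)%:E)%E).
  by apply: emeasurable_funM => //; apply/measurable_EFinP; exact: measurable_weight.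
have w0 x u : (0 <= f u * (weight nu n.+1 (y + x) u)%:E)%E.
  by rewrite mule_ge0// lee_fin ltW// weight_gt0.
under eq_integral => x _.
  rewrite /weight_mean -ge0_integralZl//; last by rewrite lee_fin.
  over.
rewrite (fubini_tonelli (m1 := nu) (m2 := mu)
  (fun z => ((phi z.1)%:E * (f z.2 * (weight nu n.+1 (y + z.1) z.2)%:E))%E)) /=; last 2 first.
- apply: emeasurable_funM.
    by apply/measurable_EFinP; apply: measurableT_comp => //; exact: measurable_fst.
  apply: emeasurable_funM.
    by apply: measurableT_comp => //; exact: measurable_snd.
  apply/measurable_EFinP.
  rewrite /weight; apply: measurableT_comp => //; apply: measurable_funB.
    apply: measurable_funM; first exact: measurable_snd.
    by apply: measurable_funD => //; exact: measurable_fst.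
  apply: measurable_funM => //.
  by apply: measurableT_comp; [exact: measurable_log_partition|exact: measurable_snd].
- by move=> z; rewrite mule_ge0// lee_fin.
apply: eq_integral => u _.
under eq_integral => x _.
  rewrite (_ : _ * _ = (f u * (weight nu n y u)%:E) * (phi x * p nu u x)%:E)%E; last first.
    by rewrite weightS [in LHS]EFinM [in RHS]EFinM muleCA -muleA; congr (_ * _)%E; rewrite muleCA.
  over.
rewrite /= ge0_integralZl//.
- by rewrite /obs_mean muleAC.
- apply/measurable_EFinP/measurable_funM => //; exact: measurable_p.
- by move=> x _; rewrite lee_fin mulr_ge0// expR_ge0.
- by rewrite mule_ge0// lee_fin ltW// weight_gt0.
Qed.

End exponential_family_facts.


(** * Posterior masses *)

(** A nonnegative combination of exponentials is convex, so its sublevel set at 1 is an interval.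
    The density of a mixture of posteriors has this form. *)
Lemma expR_combination_convex {R : realType} (l1 l3 a b u v w : R) : 0 <= l1 -> 0 <= l3 ->
  u <= v <= w -> l1 * expR (a * u) + l3 * expR (b * u) <= 1 ->
  l1 * expR (a * w) + l3 * expR (b * w) <= 1 ->
  l1 * expR (a * v) + l3 * expR (b * v) <= 1.
Proof.
move=> l10 l30 /andP[uv vw] hu hw.
have [wu|uw] := leP w u.
  by have -> : v = u by apply/eqP; rewrite eq_le uv (le_trans vw wu).
pose t := (w - v) / (w - u).
have wu0 : 0 < w - u by rewrite subr_gt0.
have t01 : 0 <= t <= 1.
  by rewrite /t divr_ge0 ?subr_ge0// ?(ltW uw)//= ler_pdivrMr// mul1r lerB.
have e k : expR (k * v) <= t * expR (k * u) + (1 - t) * expR (k * w).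
  have /andP[t0 t1] := t01.
  have H : expR (t * (k * u) + (1 - t) * (k * w)) <= _ :=
    convex_expR (Itv01 t0 t1) (k * u) (k * w).
  apply: le_trans H; rewrite le_eqVlt; apply/orP; left; apply/eqP; congr expR.
  by rewrite /t; field; rewrite gt_eqF.
have /andP[t0 t1] := t01.
have := ler_wpM2l l10 (e a); have := ler_wpM2l l30 (e b).
have : 0 <= t * (1 - (l1 * expR (a * u) + l3 * expR (b * u))) by rewrite mulr_ge0 ?subr_ge0.
have : 0 <= (1 - t) * (1 - (l1 * expR (a * w) + l3 * expR (b * w))) by rewrite mulr_ge0 ?subr_ge0.
clear; lra.
Qed.

Lemma continuous_exists_zero {R : realType} (g : R -> R) a b : continuous g -> 0 <= g a -> g b <= 0 ->
  exists y, g y = 0.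
Proof.
move=> cg ga gb; have [ab|ba] := leP a b.
  have [||y _ gy] := @IVT R g a b 0 ab; last by exists y.
    by apply: continuous_subspaceT.
  by rewrite ge_min le_max ga gb orbT.
have [||y _ gy] := @IVT R g b a 0 (ltW ba); last by exists y.
  by apply: continuous_subspaceT.
by rewrite ge_min le_max ga gb orbT.
Qed.

Lemma ge0_combinationD {R : realType} (l1 l3 x1 x3 y1 y3 : \bar R) :
  (0 <= x1 -> 0 <= x3 -> 0 <= y1 -> 0 <= y3 ->
  l1 * (x1 + y1) + l3 * (x3 + y3) = l1 * x1 + l3 * x3 + (l1 * y1 + l3 * y3))%E.
Proof. by move=> *; rewrite !ge0_muleDr// addeACA. Qed.

Lemma min_ge_combination {R : realType} (l1 l3 a1 a3 b1 b3 a2 b2 : R) : 0 <= l1 -> 0 <= l3 ->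
  l1 * a1 + l3 * a3 <= a2 -> l1 * b1 + l3 * b3 <= b2 ->
  l1 * Num.min a1 b1 + l3 * Num.min a3 b3 <= Num.min a2 b2.
Proof.
move=> l10 l30 ha hb; rewrite le_min; apply/andP; split.
  by apply: le_trans ha; rewrite lerD// ler_wpM2l// ge_min lexx.
by apply: le_trans hb; rewrite lerD// ler_wpM2l// ge_min lexx orbT.
Qed.

Section bayes_weights.
Context {R : realType} (nu : {sigma_finite_measure set R -> \bar R}).
Context (mu : probability R R) (theta0 : R).
Hypothesis nu_neq0 : nu setT <> 0%E.
Hypothesis mu_concentrated : mu (interior (Ndom nu)) = 1%E.
Hypothesis mu_Splus : (0 < mu (Splus mu theta0) < 1)%E.
Hypothesis weight_fin : forall (n : nat) (y : R),
  (weight_int nu mu n y (msupport mu) < +oo)%E.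

(** The half-lines stand for the two parts of the support, from which they differ by null sets. *)
Definition upper : set R := [set` `]theta0, +oo[%R].
Definition lower : set R := [set` `]-oo, theta0]%R].
Definition mass (A : set R) (n : nat) (y : R) : R := fine (weight_int nu mu n y A).
Definition Nint : set R := interior (Ndom nu).

Lemma measurable_upper : measurable upper. Proof. exact: measurable_itv. Qed.
Lemma measurable_lower : measurable lower. Proof. exact: measurable_itv. Qed.
Hint Resolve measurable_upper measurable_lower : core.

Lemma lowerE : lower = ~` upper.
Proof.
apply/seteqP; split => u; rewrite /upper /lower /= !in_itv /= ?andbT.
  by move=> ?; apply/negP; rewrite -leNgt.
by move/negP; rewrite -leNgt.
Qed.

Lemma measurable_Nint : measurable Nint.
Proof. by apply: open_measurable; exact: open_interior. Qed.
Hint Resolve measurable_Nint : core.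

Lemma NintC_null : mu (~` Nint) = 0%E.
Proof.
rewrite probability_setC//; have -> : mu Nint = 1%E by exact: mu_concentrated.
by rewrite subee.
Qed.

Lemma measurable_msupport : measurable (msupport mu).
Proof. by apply: closed_measurable; exact: msupport_closed. Qed.
Hint Resolve measurable_msupport : core.

Lemma measurable_weightE (A : set R) n y : measurable_fun A (fun u => (weight nu n y u)%:E).
Proof. by apply/measurable_EFinP/measurable_funTS; exact: measurable_weight. Qed.
Hint Resolve measurable_weightE : core.

Lemma weight_ge0 n y u : 0 <= weight nu n y u.
Proof. exact: expR_ge0. Qed.
Hint Resolve weight_ge0 : core.

Lemma integral_full (A C : set R) (f : R -> \bar R) : measurable A -> measurable C ->
  mu (~` C) = 0%E -> measurable_fun A f -> (forall u, A u -> 0 <= f u)%E ->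
  (\int[mu]_(u in A) f u = \int[mu]_(u in A `&` C) f u)%E.
Proof.
move=> mA mC C0 mf f0.
by rewrite (ge0_negligible_integral (measurableC mC) mA mf f0 C0) setDE setCK.
Qed.

Lemma weight_int_msupport (A : set R) n y : measurable A ->
  weight_int nu mu n y (A `&` msupport mu) = weight_int nu mu n y A.
Proof.
move=> mA; apply/esym/integral_full => //; first exact: msupport_full.
by move=> u _; rewrite lee_fin.
Qed.

Lemma weight_int_Nint (A : set R) n y : measurable A ->
  weight_int nu mu n y (A `&` Nint) = weight_int nu mu n y A.
Proof.
move=> mA; apply/esym/integral_full => //; first exact: NintC_null.
by move=> u _; rewrite lee_fin.
Qed.

Lemma weight_int_ge0 (A : set R) n y : (0 <= weight_int nu mu n y A)%E.
Proof. by apply: integral_ge0 => u _; rewrite lee_fin. Qed.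

Lemma weight_int_fin (A : set R) n y : measurable A -> weight_int nu mu n y A \is a fin_num.
Proof.
move=> mA; rewrite ge0_fin_numE ?weight_int_ge0//.
apply: le_lt_trans (weight_fin n y).
rewrite -(weight_int_msupport _ _ _ mA).
apply: ge0_subset_integral => //; first exact: measurableI.
by move=> u _; rewrite lee_fin.
Qed.

Lemma massE (A : set R) n y : measurable A -> (mass A n y)%:E = weight_int nu mu n y A.
Proof. by move=> mA; rewrite fineK// weight_int_fin. Qed.

Lemma mass_ge0 (A : set R) n y : 0 <= mass A n y.
Proof. by rewrite fine_ge0// weight_int_ge0. Qed.
Hint Resolve mass_ge0 : core.

Lemma mass_gt0 (A : set R) n y : measurable A -> mu A != 0%E -> 0 < mass A n y.
Proof.
move=> mA A0; rewrite lt_neqAle mass_ge0 andbT eq_sym; apply: contra A0 => /eqP m0.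
have : (\int[mu]_(u in A) `|(weight nu n y u)%:E| = 0)%E.
  rewrite (eq_integral (fun u => (weight nu n y u)%:E)); last first.
    by move=> u _; rewrite gee0_abs// lee_fin.
  by rewrite -[LHS]/(weight_int nu mu n y A) -massE// m0.
move/(ae_eq_integral_abs mu mA (measurable_weightE A n y)) => [N [mN N0 sub]].
apply/eqP/(subset_measure0 mA mN _ N0) => u Au; apply: sub => /= /(_ Au).
by move=> [] /eqP; rewrite gt_eqF// weight_gt0.
Qed.

Lemma mu_upperE : mu upper = mu (Splus mu theta0).
Proof.
apply/eqP; rewrite eq_le; apply/andP; split; last first.
  apply: le_measure; rewrite ?inE//; last by apply: subIsetr.
  by apply: measurableI => //; exact: measurable_upper.
rewrite (measureDI mu measurable_upper measurable_msupport).
rewrite [X in (X + _)%E](_ : _ = 0%E) ?add0e.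
  apply: le_measure; rewrite ?inE//; [exact: measurableI|exact: measurableI|].
  by rewrite setIC.
apply: (subset_measure0 _ _ _ (msupport_full mu)).
- exact: measurableD.
- exact: measurableC.
- by move=> u [].
Qed.

Lemma mu_upper_neq0 : mu upper != 0%E.
Proof. by rewrite mu_upperE; case/andP: mu_Splus => /gt_eqF ->. Qed.

Lemma mu_lower_neq0 : mu lower != 0%E.
Proof.
rewrite lowerE probability_setC//; case/andP: mu_Splus => _.
by rewrite -mu_upperE => lt1; rewrite gt_eqF// sube_gt0.
Qed.

Lemma upper_gt0 n y : 0 < mass upper n y.
Proof. by apply: mass_gt0 => //; exact: mu_upper_neq0. Qed.

Lemma lower_gt0 n y : 0 < mass lower n y.
Proof. by apply: mass_gt0 => //; exact: mu_lower_neq0. Qed.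

Lemma massT n y : mass setT n y = mass upper n y + mass lower n y.
Proof.
apply: EFin_inj; rewrite EFinD !massE// /weight_int -ge0_integral_setU//.
- by rewrite lowerE setUv.
- by move=> u _; rewrite lee_fin.
- by rewrite lowerE disj_set2E setICr.
Qed.

Lemma massT_gt0 n y : 0 < mass setT n y.
Proof. by rewrite massT addr_gt0 ?upper_gt0 ?lower_gt0. Qed.

Lemma qE n y : q nu mu theta0 n y = mass upper n y / mass setT n y.
Proof.
rewrite /q /mass; congr (fine _ / fine _).
  by rewrite -(weight_int_msupport upper)// setIC.
by rewrite -(weight_int_msupport setT)// setTI.
Qed.

Lemma weight_int_weight_mean (A : set R) n y : measurable A ->
  weight_int nu mu n y A = weight_mean nu mu (EFin \o \1_A) n y.
Proof.
move=> mA; rewrite /weight_int integral_mkcond; apply: eq_integral => u _.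
by rewrite patchE /= indicE; case: ifPn => _; rewrite ?mul1e ?mul0e.
Qed.

Lemma measurable_mass (A : set R) n : measurable A -> measurable_fun setT (mass A n).
Proof.
move=> mA; rewrite /mass.
apply: measurableT_comp; first exact: fine_measurable.
rewrite (_ : (fun y => _) = weight_mean nu mu (EFin \o \1_A) n); last first.
  by apply/funext => y; rewrite weight_int_weight_mean.
apply: measurable_weight_mean; last by move=> u /=; rewrite lee_fin.
by apply/measurable_EFinP; exact: measurable_indic.
Qed.

Lemma mass_le (A : set R) n y y' k : measurable A -> 0 <= k ->
  (forall u, A u -> k * weight nu n y u <= weight nu n y' u) ->
  k * mass A n y <= mass A n y'.
Proof.
move=> mA k0 kw; rewrite -lee_fin EFinM !massE// /weight_int -ge0_integralZl_EFin//.
- apply: ge0_le_integral => //.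
  + by move=> u _; rewrite -EFinM lee_fin mulr_ge0.
  + by apply: measurable_funeM; exact: measurable_weightE.
- by move=> u _; rewrite lee_fin.
Qed.

(** A change of score is an exponential tilt; on a half-line it is bounded on one side by its value
    at the end point, which yields the two mass estimates that follow. *)
Lemma weight_shift n y y' u : weight nu n y' u = expR (u * (y' - y)) * weight nu n y u.
Proof. by rewrite /weight -expRD; congr expR; ring. Qed.

Lemma mass_shift_ge (A : set R) n (th y y' : R) :
  measurable A -> (forall u, A u -> th <= u) -> y <= y' ->
  expR (th * (y' - y)) * mass A n y <= mass A n y'.
Proof.
move=> mA Ath yy'; apply: mass_le => // u /Ath thu.
by rewrite (weight_shift n y y') ler_wpM2r// ler_expR ler_wpM2r// subr_ge0.
Qed.

Lemma mass_shift_le (A : set R) n (th y y' : R) :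
  measurable A -> (forall u, A u -> u <= th) -> y <= y' ->
  mass A n y' <= expR (th * (y' - y)) * mass A n y.
Proof.
move=> mA Ath yy'.
have : expR (th * (y - y')) * mass A n y' <= mass A n y.
  apply: mass_le => // u /Ath uth.
  rewrite (weight_shift n y' y) ler_wpM2r// ler_expR ler_wnM2r// subr_le0//.
rewrite -(ler_pM2l (expR_gt0 (th * (y' - y)))) mulrA -expRD -mulrDr.
by rewrite addrA subrK subrr mulr0 expR0 mul1r.
Qed.

Lemma upper_ge u : upper u -> theta0 <= u.
Proof. by rewrite /upper /= in_itv /= andbT => /ltW. Qed.

Lemma lower_le u : lower u -> u <= theta0.
Proof. by rewrite /lower /= in_itv /=. Qed.

(** From [y] to [y'] the upper mass grows at least, and the lower mass at most, by the same factor,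
    the tilt at [theta0]. *)
Lemma q_nondecreasing n : {homo q nu mu theta0 n : y y' / y <= y'}.
Proof.
move=> y y' yy'; rewrite !qE.
rewrite ler_pdivrMr ?massT_gt0// mulrAC ler_pdivlMr ?massT_gt0// !massT.
have H1 := mass_shift_ge _ n _ _ _ measurable_upper upper_ge yy'.
have H2 := mass_shift_le _ n _ _ _ measurable_lower lower_le yy'.
have e0 := expR_gt0 (theta0 * (y' - y)).
move: (expR _) H1 H2 e0 => e H1 H2 e0.
have u0 := upper_gt0 n y; have l0 := lower_gt0 n y.
have : mass upper n y * mass lower n y' <= mass upper n y * (e * mass lower n y).
  by rewrite ler_pM2l.
have : e * mass upper n y * mass lower n y <= mass upper n y' * mass lower n y.
  by rewrite ler_pM2r.
clear; move: (mass _ _ _) (mass _ _ _) (mass _ _ _) (mass _ _ _) => a b a' b'.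
nra.
Qed.

(** An instance of [weight_meanS]. On [Nint], which has full measure, the conditional mean of [phi]
    is at most 1, so [fine] loses nothing. *)
Lemma mass_convolution (A : set R) (phi : R -> R) n y : measurable A -> measurable_fun setT phi ->
  (forall x, 0 <= phi x <= 1) ->
  (\int[nu]_x (phi x * mass A n.+1 (y + x))%:E =
   \int[mu]_(u in A `&` Nint) (fine (obs_mean nu phi u) * weight nu n y u)%:E)%E.
Proof.
move=> mA mphi phi01.
have phi0 x : 0 <= phi x by have /andP[] := phi01 x.
have m1A : measurable_fun setT (EFin \o \1_A : R -> \bar R).
  by apply/measurable_EFinP; exact: measurable_indic.
have mobs : measurable_fun setT (obs_mean nu phi) by exact: measurable_obs_mean.
under eq_integral => x _ do rewrite EFinM massE// weight_int_weight_mean//.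
rewrite weight_meanS//; last by move=> u /=; rewrite lee_fin.
rewrite /weight_mean (integral_full setT Nint)//; last 3 first.
- exact: NintC_null.
- apply: emeasurable_funM; last exact: measurable_weightE.
  exact: emeasurable_funM.
- by move=> u _; rewrite !mule_ge0 ?lee_fin// obs_mean_ge0.
rewrite setTI setIC integral_mkcondr; apply: eq_integral => u /[!inE] Nu.
rewrite patchE /= indicE; case: ifPn => _; rewrite ?mul1e ?mul0e//.
rewrite EFinM fineK// ge0_fin_numE ?obs_mean_ge0//.
apply: le_lt_trans (obs_mean_le1 nu nu_neq0 _ _ _ mphi phi01) _; last exact: ltry.
exact: interior_subset Nu.
Qed.

(** The martingale property of posterior probabilities, without normalization. *)
Lemma mass_convolution1 (A : set R) n y : measurable A ->
  (\int[nu]_x (mass A n.+1 (y + x))%:E = (mass A n y)%:E)%E.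
Proof.
move=> mA; under eq_integral do rewrite -[mass A _ _]mul1r.
rewrite (mass_convolution _ (fun=> 1))//; last by move=> x; rewrite ler01 lexx.
rewrite massE// -weight_int_Nint//; apply: eq_integral => u /[!inE] -[_ Nu].
congr (_%:E); rewrite /obs_mean.
under eq_integral do rewrite mul1r.
by rewrite p_int1//= ?mul1r//; exact: interior_subset Nu.
Qed.

Lemma mass_Nint (A : set R) n y : measurable A -> mass (A `&` Nint) n y = mass A n y.
Proof. by move=> mA; rewrite /mass weight_int_Nint. Qed.

Lemma mass_subset (A C : set R) n y : measurable A -> measurable C -> A `<=` C ->
  mass A n y <= mass C n y.
Proof.
move=> mA mC AC; rewrite fine_le ?weight_int_fin//; apply: ge0_subset_integral => //.
by move=> u _; rewrite lee_fin.
Qed.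

(* Failing unifications would otherwise unfold the integrals. *)
#[local] Opaque mass.

Lemma mass_combination (A : set R) n s1 s3 l1 l3 : measurable A -> 0 <= l1 -> 0 <= l3 ->
  (\int[mu]_(u in A) (l1 * weight nu n s1 u + l3 * weight nu n s3 u)%:E =
   (l1 * mass A n s1 + l3 * mass A n s3)%:E)%E.
Proof.
move=> mA l10 l30; under eq_integral do rewrite EFinD !EFinM.
rewrite ge0_integralD//; last 4 first.
- by move=> u _; rewrite -EFinM lee_fin mulr_ge0.
- by apply: measurable_funeM; exact: measurable_weightE.
- by move=> u _; rewrite -EFinM lee_fin mulr_ge0.
- by apply: measurable_funeM; exact: measurable_weightE.
rewrite !ge0_integralZl_EFin//; do ?[by move=> u _; rewrite lee_fin].
by rewrite EFinD !EFinM !massE.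
Qed.

Lemma mu_Nint (A : set R) : measurable A -> mu A != 0%E -> mu (A `&` Nint) != 0%E.
Proof.
move=> mA; apply: contra => /eqP A0.
rewrite (measureDI mu mA measurable_Nint) [X in (_ + X)%E](_ : _ = 0%E) ?adde0; last exact: A0.
apply/eqP.
apply: (subset_measure0 _ _ _ NintC_null); first exact: measurableD.
- exact: measurableC.
- by move=> u [].
Qed.

(* The ratio [w13 / w2] is convex and has mean 1 on [upper] and on [lower]; so it
   is at most 1 somewhere on each of them, hence exceeds 1 only to the right of a
   threshold on [upper] and only to the left of one on [lower]. *)
Section balanced_crossing.
Variables (n : nat) (s1 s2 s3 l1 l3 : R).
Hypothesis bal : balanced (mass upper n) (mass lower n) s1 s2 s3 l1 l3.

Let w13 u := l1 * weight nu n s1 u + l3 * weight nu n s3 u.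
Let w2 u := weight nu n s2 u.

Let w13_le u : (w13 u <= w2 u) =
  (l1 * expR ((s1 - s2) * u) + l3 * expR ((s3 - s2) * u) <= 1).
Proof.
rewrite /w13 /w2 (weight_shift n s2 s1) (weight_shift n s2 s3).
rewrite ![u * (_ - _)]mulrC !mulrA -mulrDl -[X in _ <= X]mul1r.
by rewrite ler_pM2r// weight_gt0.
Qed.

Let w13_lt u : (w2 u < w13 u) =
  ~~ (l1 * expR ((s1 - s2) * u) + l3 * expR ((s3 - s2) * u) <= 1).
Proof. by rewrite ltNge w13_le. Qed.

Let mw13 A : measurable_fun A w13.
Proof.
apply: measurable_funTS; apply: measurable_funD; apply: measurable_funM => //;
  exact: measurable_weight.
Qed.

Let mw2 A : measurable_fun A w2.
Proof. by apply: measurable_funTS; exact: measurable_weight. Qed.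

Let w13_ge0 u : 0 <= w13 u.
Proof. by case: bal => l10 l30 _ _; rewrite addr_ge0 ?mulr_ge0. Qed.

Let w13_mass A : measurable A -> mass A n s2 = l1 * mass A n s1 + l3 * mass A n s3 ->
  (\int[mu]_(u in A `&` Nint) (w13 u)%:E = \int[mu]_(u in A `&` Nint) (w2 u)%:E)%E.
Proof.
move=> mA e; have mAN : measurable (A `&` Nint) by exact: measurableI.
case: bal => l10 l30 _ _.
rewrite mass_combination// !mass_Nint// -e -mass_Nint// massE//.
Qed.

Let w2_fin A : measurable A -> (\int[mu]_(u in A `&` Nint) (w2 u)%:E < +oo)%E.
Proof.
move=> mA; have mAN : measurable (A `&` Nint) by exact: measurableI.
by rewrite -[X in (X < _)%E]/(weight_int nu mu n s2 _) -massE// ltry.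
Qed.

Let exists_le A : measurable A -> mu A != 0%E ->
  mass A n s2 = l1 * mass A n s1 + l3 * mass A n s3 ->
  exists2 u, (A `&` Nint) u & w13 u <= w2 u.
Proof.
move=> mA A0 e.
apply: (@eq_integral_exists_le _ _ _ mu (A `&` Nint)) => //.
- exact: measurableI.
- by move=> u _; exact: weight_ge0.
- exact: w13_mass.
- exact: w2_fin.
- exact: mu_Nint.
Qed.

Lemma upper_crossing (phi : R -> R) : measurable_fun setT phi ->
  (forall u, Nint u -> 0 <= phi u <= 1) ->
  (forall u v, Nint u -> Nint v -> u <= v -> phi v <= phi u) ->
  (\int[mu]_(u in upper `&` Nint) (phi u * w13 u)%:E <=
   \int[mu]_(u in upper `&` Nint) (phi u * w2 u)%:E)%E.
Proof.
move=> mphi phi01 phi_dec; have [l10 l30 eu el] := bal.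
(* The point is taken in [lower], hence to the left of all of [upper]: from there to any [v] in
   [upper] with [w13 v <= w2 v], the ratio stays at most 1. *)
have [u0 [u0l _]] := exists_le _ measurable_lower mu_lower_neq0 el.
rewrite w13_le => h0.
apply: crossing_integral_le => //.
- exact: measurableI.
- by move=> u _; exact: weight_ge0.
- exact: w13_mass.
- exact: w2_fin.
- exact: measurable_funTS.
- by move=> u [_ /phi01].
move=> u v [uu Nu] [vu Nv]; move=> hv hu.
rewrite w13_le in hv; rewrite w13_lt in hu.
rewrite leNgt; apply/negP => ltphi; move/negP: hu; apply.
have uv : u <= v by rewrite leNgt; apply/negP => /ltW /(phi_dec _ _ Nv Nu); rewrite leNgt ltphi.
apply: expR_combination_convex h0 hv => //.
by rewrite uv andbT (le_trans (lower_le _ u0l)) ?upper_ge.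
Qed.

Lemma lower_crossing (phi : R -> R) : measurable_fun setT phi ->
  (forall u, Nint u -> 0 <= phi u <= 1) ->
  (forall u v, Nint u -> Nint v -> u <= v -> phi u <= phi v) ->
  (\int[mu]_(u in lower `&` Nint) (phi u * w13 u)%:E <=
   \int[mu]_(u in lower `&` Nint) (phi u * w2 u)%:E)%E.
Proof.
move=> mphi phi01 phi_inc; have [l10 l30 eu el] := bal.
have [u0 [u0u _]] := exists_le _ measurable_upper mu_upper_neq0 eu.
rewrite w13_le => h0.
apply: crossing_integral_le => //.
- exact: measurableI.
- by move=> u _; exact: weight_ge0.
- exact: w13_mass.
- exact: w2_fin.
- exact: measurable_funTS.
- by move=> u [_ /phi01].
move=> u v [ul Nu] [vl Nv]; move=> hv hu.
rewrite w13_le in hv; rewrite w13_lt in hu.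
rewrite leNgt; apply/negP => ltphi; move/negP: hu; apply.
have vu : v <= u by rewrite leNgt; apply/negP => /ltW /(phi_inc _ _ Nu Nv); rewrite leNgt ltphi.
apply: expR_combination_convex hv h0 => //.
by rewrite vu /= (le_trans (lower_le _ ul)) ?upper_ge.
Qed.

End balanced_crossing.

(** * The posterior probability takes every value in (0, 1) *)

Lemma continuous_mass (A : set R) n : measurable A -> continuous (mass A n).
Proof.
move=> mA y.
have int_w s : mu.-integrable A (EFin \o weight nu n s).
  apply/integrableP; split; first exact: measurable_weightE.
  rewrite (eq_integral (fun u => (weight nu n s u)%:E)); last first.
    by move=> u _ /=; rewrite ger0_norm.
  by rewrite -[X in (X < _)%E]/(weight_int nu mu n s A) -massE// ltry.
have yI : y \in ([set` `]y - 1, y + 1[%R] : set R) by rewrite inE /= in_itv /=; lra.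
(* The weight is monotone in the score, in a direction given by the sign of [u]; so the sum of the
   weights at [y - 1] and [y + 1] dominates in between. *)
apply: (@continuity_under_integral R _ _ mu (fun s u => weight nu n s u) A mA
  (y - 1) (y + 1) _ _ (fun u => weight nu n (y - 1) u + weight nu n (y + 1) u)) yI.
- by move=> s _; exact: int_w.
- apply: aeW => u _ s _.
  rewrite /weight; apply: continuous_comp; last exact: continuous_expR.
  apply: continuousB; last exact: cst_continuous.
  by apply: continuousM => //; exact: cst_continuous.
- rewrite /= (_ : EFin \o _ =
    (EFin \o weight nu n (y - 1)) \+ (EFin \o weight nu n (y + 1)))%E//.
  exact: integrableD.
- move=> s; rewrite /= in_itv /= => /andP[ys sy]; apply: aeW => u _.
  rewrite ger0_norm//.
  have [u0|u0] := leP 0 u.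
    rewrite ler_wpDl// /weight ler_expR lerB// ler_wpM2l// ltW//.
  by rewrite ler_wpDr// /weight ler_expR lerB// ler_wnM2l// ltW.
Qed.

(** Some part [U k] of [upper] at positive distance from [theta0] is not null, since these parts
    exhaust [upper]. Its mass outgrows the lower mass exponentially in the score. *)
Lemma ratio_large n M : 0 <= M -> exists s, M * mass lower n s <= mass upper n s.
Proof.
move=> M0.
pose U (k : nat) : set R := [set` `]theta0 + k.+1%:R^-1, +oo[%R].
have mU k : measurable (U k) by exact: measurable_itv.
have [k Uk] : exists k, mu (U k) != 0%E.
  apply: contrapT => /forallNP U0; case/negP: mu_upper_neq0; apply/eqP.
  have sub : upper `<=` \bigcup_k U k.
    move=> u; rewrite /upper /= in_itv /= andbT => /ltr_add_invr[k ku].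
    by exists k => //; rewrite /U /= in_itv /= ku.
  apply: (subset_measure0 measurable_upper _ sub); first exact: bigcupT_measurable.
  apply/eqP; rewrite eq_le measure_ge0 andbT.
  apply: le_trans (measure_sigma_subadditive mu mU _ (@subset_refl _ _)) _.
    exact: bigcupT_measurable.
  rewrite eseries0// => k _ _; apply/eqP; apply: contrapT => /negP Uk; exact: (U0 k).
set C := mass (U k) n 0; have C0 : 0 < C by exact: mass_gt0.
set L := mass lower n 0; have L0 : 0 < L by exact: lower_gt0.
set e : R := k.+1%:R^-1; have e0 : 0 < e by rewrite /e invr_gt0.
(* Chosen so that [M * L / C = e * s], which is at most [expR (e * s)]. *)
pose s := M * L / (C * e).
have s0 : 0 <= s by rewrite /s divr_ge0 ?mulr_ge0// ltW.
exists s.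
have UkU : mass (U k) n s <= mass upper n s.
  apply: mass_subset => // u; rewrite /U /upper /= !in_itv /= !andbT; apply: le_lt_trans.
  by rewrite lerDl ltW.
apply: le_trans UkU.
have H1 : mass lower n s <= expR (theta0 * s) * L.
  by have := mass_shift_le _ n _ _ _ measurable_lower lower_le s0; rewrite subr0.
have H2 : expR ((theta0 + e) * s) * C <= mass (U k) n s.
  have := @mass_shift_ge (U k) n (theta0 + e) 0 s (mU k); rewrite subr0; apply => //.
  by move=> u; rewrite /U /= in_itv /= andbT => /ltW.
apply: le_trans H2; apply: le_trans (ler_wpM2l M0 H1) _.
rewrite mulrDl expRD mulrCA -[leRHS]mulrA ler_wpM2l ?expR_ge0//.
rewrite -ler_pdivrMr//.
have -> : M * L / C = e * s by rewrite /s; field; rewrite !gt_eqF.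
by apply: le_trans (expR_ge1Dx _); rewrite lerDr.
Qed.

(** Divided by the tilt at [theta0], the lower mass at negative scores is at least its value at 0,
    while the upper mass tends to 0 as the score decreases. The support may accumulate at [theta0]
    from above, so there is no exponential rate, and dominated convergence takes its place. *)
Lemma ratio_small n M : 0 <= M -> exists s, M * mass upper n s <= mass lower n s.
Proof.
move=> M0.
pose f (k : nat) u := (expR (theta0 * k%:R) * weight nu n (- k%:R) u)%:E.
have fE k u : f k u = (expR (- (u - theta0)) ^+ k * weight nu n 0 u)%:E.
  rewrite /f (weight_shift n 0) mulrA -expRD -expRM_natl; congr ((expR _ * _)%:E); ring.
have mf k : measurable_fun upper (f k).
  apply/measurable_EFinP/measurable_funTS/measurable_funM => //; exact: measurable_weight.
have DC := @dominated_convergence _ _ _ mu upper measurable_upper f (fun=> 0%E)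
  (fun u => (weight nu n 0 u)%:E) mf (measurable_cst _).
have H1 : {ae mu, forall x, upper x -> f ^~ x @ \oo --> (0%E : \bar R)}.
  apply: aeW => u uu.
  rewrite (_ : f ^~ u = fun k => (expR (- (u - theta0)) ^+ k * weight nu n 0 u)%:E); last first.
    by apply/funext => k; rewrite fE.
  apply: cvg_EFin; first by apply: nearW.
  rewrite -[X in _ --> X](mul0r (weight nu n 0 u)); apply: cvgMl.
  apply: cvg_expr; rewrite ger0_norm ?expR_ge0// -expR0 ltr_expR oppr_lt0 subr_gt0.
  by move: uu; rewrite /upper /= in_itv /= andbT.
have H2 : mu.-integrable upper (fun u => (weight nu n 0 u)%:E).
  apply/integrableP; split; first exact: measurable_weightE.
  rewrite (eq_integral (fun u => (weight nu n 0 u)%:E)); last first.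
    by move=> u _ /=; rewrite ger0_norm.
  by rewrite -[X in (X < _)%E]/(weight_int nu mu n 0 upper) -massE// ltry.
have H3 : {ae mu, forall x k, upper x -> (`|f k x| <= (weight nu n 0 x)%:E)%E}.
  apply: aeW => u k uu; rewrite fE /= lee_fin ger0_norm ?mulr_ge0 ?exprn_ge0 ?expR_ge0//.
  rewrite ler_piMl// exprn_ile1 ?expR_ge0// -expR0 ler_expR oppr_le0 subr_ge0.
  exact: upper_ge.
have [_ _] := DC H1 H2 H3; rewrite integral0 => cv.
have L0 : 0 < mass lower n 0 by exact: lower_gt0.
have [k] : exists k, (\int[mu]_(x in upper) f k x < (mass lower n 0 / (M + 1))%:E)%E.
  have : (0 < (mass lower n 0 / (M + 1))%:E)%E by rewrite lte_fin divr_gt0// ltr_wpDl.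
  by move=> /open_ereal_lt'/cv[k _ Hk]; exists k; exact: (Hk k (leqnn k)).
rewrite /f; under eq_integral do rewrite EFinM.
rewrite ge0_integralZl_EFin ?expR_ge0//; last by move=> u _; rewrite lee_fin.
rewrite -[X in (_ * X)%E]/(weight_int nu mu n (- k%:R) upper) -massE// -EFinM lte_fin => H.
exists (- k%:R).
have k0 : - k%:R <= 0 :> R by rewrite oppr_le0.
have := mass_shift_le _ n _ _ _ measurable_lower lower_le k0; rewrite sub0r opprK.
have e0 := expR_gt0 (theta0 * k%:R).
move: H; rewrite ltr_pdivlMr ?ltr_wpDl//.
rewrite -(ler_pM2l e0); move: (expR _) e0 (mass_ge0 upper n (- k%:R)) => e e0 m0 H.
have : 0 <= e * mass upper n (- k%:R) by rewrite mulr_ge0// ltW.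
move: H; clear; lra.
Qed.

Lemma q_surj n pi0 : 0 < pi0 < 1 -> exists y, q nu mu theta0 n y = pi0.
Proof.
move=> /andP[p0 p1].
(* The odds of [pi0]: a score is sought at which the two masses have this ratio. *)
pose M := pi0 / (1 - pi0).
have M0 : 0 < M by rewrite divr_gt0// subr_gt0.
pose g y := mass upper n y - M * mass lower n y.
have cg : continuous g.
  move=> y; apply: continuousB; first exact: continuous_mass.
  by apply: continuousM; [exact: cst_continuous|exact: continuous_mass].
have [a ga] : exists a, 0 <= g a.
  by have [a ha] := ratio_large n M (ltW M0); exists a; rewrite subr_ge0.
have [b gb] : exists b, g b <= 0.
  have [|b hb] := ratio_small n M^-1; first by rewrite invr_ge0 ltW.
  by exists b; rewrite subr_le0 -ler_pdivrMl.
have [y gy] := continuous_exists_zero g a b cg ga gb.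
exists y; rewrite qE massT; move: gy; rewrite /g /M => /eqP; rewrite subr_eq0 => /eqP ->.
have l0 := lower_gt0 n y; field.
rewrite subr_eq0 (gt_eqF p1) /=.
by rewrite (_ : _ + _ = mass lower n y) ?gt_eqF//; ring.
Qed.

(** [y_of] falls back on 0 when there is no preimage; surjectivity excludes this. *)
Lemma q_y_of n pi0 : 0 < pi0 < 1 -> q nu mu theta0 n (y_of nu mu theta0 n pi0) = pi0.
Proof. by move=> /(q_surj n) H; have := xgetPex 0 H. Qed.

Lemma upper_q n y : mass upper n y = q nu mu theta0 n y * mass setT n y.
Proof. by rewrite qE divfK// gt_eqF// massT_gt0. Qed.

Lemma lower_q n y : mass lower n y = (1 - q nu mu theta0 n y) * mass setT n y.
Proof. by rewrite mulrBl mul1r -upper_q massT addrAC subrr add0r. Qed.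

Lemma mass_supports n v : pair_concave (mass upper n) (mass lower n) v ->
  (forall y, 0 <= v y <= Num.min (mass upper n y) (mass lower n y)) ->
  exists a b : R -> R, [/\ {homo a : x y / x <= y >-> y <= x}, {homo b : x y / x <= y},
    (forall y, 0 <= a y <= 1 /\ 0 <= b y <= 1),
    (forall y y', v y <= a y' * mass upper n y + b y' * mass lower n y) &
    (forall y, v y = a y * mass upper n y + b y * mass lower n y)].
Proof.
apply: pair_concave_supports.
- by move=> y; exact: upper_gt0.
- by move=> y; exact: lower_gt0.
- by move=> pi0 /(q_surj n)[y <-]; exists y; rewrite qE massT.
- by move=> x y /(q_nondecreasing n); rewrite !qE !massT.
Qed.

#[local] Opaque obs_mean weight_mean.

(** * Balanced scores compared after one more observation *)

Section convolution_crossing.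
Variables (n : nat) (s1 s2 s3 l1 l3 : R).
Hypothesis bal : balanced (mass upper n) (mass lower n) s1 s2 s3 l1 l3.
Variable phi : R -> R.
Hypotheses (mphi : measurable_fun setT phi) (phi01 : forall x, 0 <= phi x <= 1).

Let mean u := fine (obs_mean nu phi u).

Let phi0 x : 0 <= phi x. Proof. by have /andP[] := phi01 x. Qed.

Let mmean : measurable_fun setT mean.
Proof.
by apply: measurableT_comp; [exact: fine_measurable|exact: measurable_obs_mean].
Qed.

Let mean_fin u : Nint u -> obs_mean nu phi u \is a fin_num.
Proof.
move=> Nu; rewrite ge0_fin_numE ?obs_mean_ge0//.
apply: le_lt_trans (obs_mean_le1 nu nu_neq0 _ _ _ mphi phi01) _; last exact: ltry.
exact: interior_subset Nu.
Qed.

Let mean01 u : Nint u -> 0 <= mean u <= 1.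
Proof.
move=> Nu; rewrite -!lee_fin fineK ?mean_fin// obs_mean_ge0//=.
by apply: obs_mean_le1 => //; exact: interior_subset Nu.
Qed.

Let I A s := (\int[nu]_x (phi x * mass A n.+1 (s + x))%:E)%E.

Let I_combination A : measurable A ->
  (l1%:E * I A s1 + l3%:E * I A s3 =
   \int[mu]_(u in A `&` Nint)
     (mean u * (l1 * weight nu n s1 u + l3 * weight nu n s3 u))%:E)%E.
Proof.
move=> mA; have [l10 l30 _ _] := bal.
have mAN : measurable (A `&` Nint) by exact: measurableI.
have mw y : measurable_fun (A `&` Nint) (fun u => (mean u * weight nu n y u)%:E).
  by apply/measurable_EFinP/measurable_funTS/measurable_funM => //; exact: measurable_weight.
have w0 y u : (A `&` Nint) u -> (0 <= (mean u * weight nu n y u)%:E)%E.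
  by move=> [_ /mean01/andP[m0 _]]; rewrite lee_fin mulr_ge0.
rewrite /I !mass_convolution// -!ge0_integralZl_EFin//; do ?[by move=> u; exact: w0].
rewrite -ge0_integralD//.
- by apply: eq_integral => u _; rewrite -!EFinM -EFinD; congr (_%:E); rewrite /mean; ring.
- by move=> u Au; rewrite mule_ge0 ?lee_fin//; exact: w0.
- exact: measurable_funeM.
- by move=> u Au; rewrite mule_ge0 ?lee_fin//; exact: w0.
- exact: measurable_funeM.
Qed.

(** Integrating out the observation replaces [phi] by its conditional mean, which on [Nint] is
    decreasing with values in [0, 1], as [upper_crossing] requires. *)
Lemma upper_convolution_le : {homo phi : x y / x <= y >-> y <= x} ->
  (l1%:E * I upper s1 + l3%:E * I upper s3 <= I upper s2)%E.
Proof.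
move=> phi_dec; rewrite I_combination// [leRHS]/I mass_convolution//.
have mono u v : Nint u -> Nint v -> u <= v -> mean v <= mean u.
  move=> Nu Nv uv; apply: fine_le; [exact: mean_fin|exact: mean_fin|].
  by apply: obs_mean_nonincreasing => //; exact: interior_subset.
exact: (upper_crossing n s1 s2 s3 l1 l3 bal mean mmean mean01 mono).
Qed.

Lemma lower_convolution_le : {homo phi : x y / x <= y} ->
  (l1%:E * I lower s1 + l3%:E * I lower s3 <= I lower s2)%E.
Proof.
move=> phi_inc; rewrite I_combination// [leRHS]/I mass_convolution//.
have mono u v : Nint u -> Nint v -> u <= v -> mean u <= mean v.
  move=> Nu Nv uv; apply: fine_le; [exact: mean_fin|exact: mean_fin|].
  by apply: obs_mean_nondecreasing => //; exact: interior_subset.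
exact: (lower_crossing n s1 s2 s3 l1 l3 bal mean mmean mean01 mono).
Qed.

End convolution_crossing.

(** * The truncated problems *)

Variable c : R.
Hypothesis c_ge0 : 0 <= c.

Definition stop_value n y := Num.min (mass upper n y) (mass lower n y).

(* [value N n y / mass setT n y] is the optimal risk when at most [N] further
   observations are allowed. *)
Fixpoint value (N n : nat) (y : R) : R :=
  if N is N'.+1 then
    Num.min (stop_value n y)
      (c * mass setT n y + fine (\int[nu]_x (value N' n.+1 (y + x))%:E)%E)
  else stop_value n y.

Lemma stop_value_ge0 n y : 0 <= stop_value n y.
Proof. by rewrite /stop_value le_min !mass_ge0. Qed.

Lemma value_bounds N n y : 0 <= value N n y <= stop_value n y.
Proof.
elim: N n y => [|N IH] n y /=; first by rewrite stop_value_ge0 lexx.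
have I0 : (0 <= \int[nu]_x (value N n.+1 (y + x))%:E)%E.
  by apply: integral_ge0 => x _; rewrite lee_fin; case/andP: (IH n.+1 (y + x)).
rewrite ge_min lexx /= andbT le_min stop_value_ge0 /=.
by rewrite addr_ge0 ?mulr_ge0// fine_ge0.
Qed.

Lemma value_ge0 N n y : 0 <= value N n y.
Proof. by case/andP: (value_bounds N n y). Qed.

Lemma measurable_stop_value n : measurable_fun setT (stop_value n).
Proof. by apply: measurable_minr; exact: measurable_mass. Qed.

Lemma measurable_shift_mean (h : R -> R) : measurable_fun setT h -> (forall y, 0 <= h y) ->
  measurable_fun setT (fun y : R => \int[nu]_x (h (y + x))%:E)%E.
Proof.
move=> mh h0.
apply: (measurable_fun_fubini_tonelli_F (fun z : R * R => (h (z.1 + z.2))%:E)).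
  apply/measurable_EFinP; apply: measurableT_comp => //.
  by apply: measurable_funD; [exact: measurable_fst|exact: measurable_snd].
by move=> z; rewrite lee_fin.
Qed.

Lemma measurable_value N n : measurable_fun setT (value N n).
Proof.
elim: N n => [|N IH] n /=; first exact: measurable_stop_value.
apply: measurable_minr; first exact: measurable_stop_value.
apply: measurable_funD.
  by apply: measurable_funM => //; exact: measurable_mass.
apply: measurableT_comp; first exact: fine_measurable.
apply: measurable_shift_mean; first exact: IH.
by move=> y; exact: value_ge0.
Qed.

Lemma measurable_value_shift N n (y : R) : measurable_fun setT (fun x => value N n (y + x)).
Proof. by apply: measurableT_comp; [exact: measurable_value|exact: measurable_funD]. Qed.

Lemma measurable_mass_shift (A : set R) n (y : R) : measurable A ->
  measurable_fun setT (fun x => mass A n (y + x)).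
Proof.
by move=> mA; apply: measurableT_comp; [exact: measurable_mass|exact: measurable_funD].
Qed.

(** The value is at most the upper mass, whose integral is the current upper mass; hence [fine] in
    the recursion loses nothing. *)
Lemma value_integral_fin N n y : (\int[nu]_x (value N n.+1 (y + x))%:E)%E \is a fin_num.
Proof.
rewrite ge0_fin_numE; last by apply: integral_ge0 => x _; rewrite lee_fin value_ge0.
apply: (@le_lt_trans _ _ (\int[nu]_x (mass upper n.+1 (y + x))%:E)%E); last first.
  by rewrite mass_convolution1// ltry.
apply: ge0_le_integral => //.
- by move=> x _; rewrite lee_fin value_ge0.
- by apply/measurable_EFinP; exact: measurable_value_shift.
- by apply/measurable_EFinP; exact: measurable_mass_shift.
- move=> x _; rewrite lee_fin; case/andP: (value_bounds N n.+1 (y + x)) => _ h.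
  by apply: le_trans h _; rewrite /stop_value ge_min lexx.
Qed.

Lemma valueS N n y : value N.+1 n y = Num.min (stop_value n y)
  (c * mass setT n y + fine (\int[nu]_x (value N n.+1 (y + x))%:E)%E).
Proof. by []. Qed.

(* Majorize the next value function by its supporting lines at the points
   [s2 + x]: both sides are then linear in the masses. *)
Lemma value_pair_concave N n : pair_concave (mass upper n) (mass lower n) (value N n).
Proof.
elim: N n => [|N IH] n s1 s2 s3 l1 l3 bal; have [l10 l30 eu el] := bal.
  by apply: min_ge_combination; rewrite ?eu ?el.
rewrite !valueS; apply: min_ge_combination => //.
  by apply: min_ge_combination; rewrite ?eu ?el.
have [a [b [a_dec b_inc ab01 ab_le ab_eq]]] := mass_supports _ _ (IH n.+1) (value_bounds N n.+1).
pose phi x := a (s2 + x); pose psi x := b (s2 + x).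
have phi01 x : 0 <= phi x <= 1 by have [] := ab01 (s2 + x).
have psi01 x : 0 <= psi x <= 1 by have [] := ab01 (s2 + x).
have phi0 x : 0 <= phi x by have /andP[] := phi01 x.
have psi0 x : 0 <= psi x by have /andP[] := psi01 x.
have phi_dec : {homo phi : x y / x <= y >-> y <= x}.
  by move=> x y xy; apply: a_dec; rewrite lerD2l.
have psi_inc : {homo psi : x y / x <= y}.
  by move=> x y xy; apply: b_inc; rewrite lerD2l.
have mphi : measurable_fun setT phi by apply: nonincreasing_measurable.
have mpsi : measurable_fun setT psi by apply: nondecreasing_measurable.
pose IU s := (\int[nu]_x (phi x * mass upper n.+1 (s + x))%:E)%E.
pose IL s := (\int[nu]_x (psi x * mass lower n.+1 (s + x))%:E)%E.
pose J s := (\int[nu]_x (value N n.+1 (s + x))%:E)%E.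
have IULE s : (IU s + IL s = \int[nu]_x
    (phi x * mass upper n.+1 (s + x) + psi x * mass lower n.+1 (s + x))%:E)%E.
  rewrite /IU /IL -ge0_integralD//.
  - by move=> x _; rewrite lee_fin mulr_ge0.
  - by apply/measurable_EFinP/measurable_funM => //; exact: measurable_mass_shift.
  - by move=> x _; rewrite lee_fin mulr_ge0.
  - by apply/measurable_EFinP/measurable_funM => //; exact: measurable_mass_shift.
have J_le s : (J s <= IU s + IL s)%E.
  rewrite IULE; apply: ge0_le_integral => //.
  - by move=> x _; rewrite lee_fin value_ge0.
  - by apply/measurable_EFinP; exact: measurable_value_shift.
  - by apply/measurable_EFinP/measurable_funD; apply: measurable_funM => //; exact: measurable_mass_shift.
  - by move=> x _; rewrite lee_fin ab_le.
(* The lines touch the value function at the points [s2 + x], so the majorization is exact at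
   [s2]. *)
have J_eq : J s2 = (IU s2 + IL s2)%E.
  by rewrite IULE; apply: eq_integral => x _; rewrite ab_eq.
have HU : (l1%:E * IU s1 + l3%:E * IU s3 <= IU s2)%E :=
  upper_convolution_le _ _ _ _ _ _ bal _ mphi phi01 phi_dec.
have HL : (l1%:E * IL s1 + l3%:E * IL s3 <= IL s2)%E :=
  lower_convolution_le _ _ _ _ _ _ bal _ mpsi psi01 psi_inc.
have I0 s : (0 <= IU s /\ 0 <= IL s)%E.
  by split; apply: integral_ge0 => x _; rewrite lee_fin mulr_ge0.
have HJ : (l1%:E * J s1 + l3%:E * J s3 <= J s2)%E.
  rewrite J_eq; apply: le_trans (leeD HU HL).
  apply: (@le_trans _ _ (l1%:E * (IU s1 + IL s1) + l3%:E * (IU s3 + IL s3))%E).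
    by apply: leeD; apply: lee_wpmul2l; rewrite ?lee_fin ?J_le.
  have [[u1 v1] [u3 v3]] := (I0 s1, I0 s3).
  by rewrite (ge0_combinationD _ _ _ _ _ _ u1 u3 v1 v3).
have fJ s : J s \is a fin_num by exact: value_integral_fin.
have : l1 * fine (J s1) + l3 * fine (J s3) <= fine (J s2).
  by rewrite -lee_fin EFinD !EFinM !fineK.
rewrite /J !massT eu el => H.
by apply: le_trans (lerD (lexx _) H); rewrite le_eqVlt; apply/orP; left; apply/eqP; ring.
Qed.

Definition bounded_risk N n (pi0 : R) : R :=
  value N n (y_of nu mu theta0 n pi0) / mass setT n (y_of nu mu theta0 n pi0).

Lemma bounded_risk_concave N n t x y : 0 <= t <= 1 -> 0 < x < 1 -> 0 < y < 1 ->
  t * bounded_risk N n x + (1 - t) * bounded_risk N n y <=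
  bounded_risk N n (t * x + (1 - t) * y).
Proof.
move=> t01 x01 y01; rewrite /bounded_risk !massT.
apply: (pair_concaveP (mass upper n) (mass lower n)) (value_pair_concave N n) _ _ _ t01 x01 y01.
- by move=> z; exact: upper_gt0.
- by move=> z; exact: lower_gt0.
- by move=> p0 /(q_y_of n); rewrite qE massT.
Qed.

(** * The law of the observations *)

Section observations.
Context {d : measure_display} {Omega : measurableType d}.
Variables (Theta : {mfun Omega >-> R}) (X : nat -> {mfun Omega >-> R}).
Variables (n : nat) (pi0 : R) (P : probability Omega R).
Hypothesis model : bayes_model nu mu theta0 Theta X n pi0 P.

Let y0 := y_of nu mu theta0 n pi0.
Let Y (i : nat) : {mfun Omega >-> R} := X (n + i).+1.

Definition score (k : nat) (w : Omega) : R := y0 + \sum_(i < k) Y i w.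

Lemma score0 w : score 0 w = y0.
Proof. by rewrite /score big_ord0 addr0. Qed.

Lemma scoreS k w : score k.+1 w = score k w + Y k w.
Proof. by rewrite /score big_ord_recr /= addrA. Qed.

Lemma historyT k : history Y k setT.
Proof. exact: (@measurableT _ (g_sigma_algebraType _)). Qed.

Lemma historyI k A C : history Y k A -> history Y k C -> history Y k (A `&` C).
Proof. exact: (@measurableI _ (g_sigma_algebraType _)). Qed.

Lemma historyC k A : history Y k A -> history Y k (~` A).
Proof. exact: (@measurableC _ (g_sigma_algebraType _)). Qed.

Lemma history_obs k i (C : set R) : (i < k)%N -> measurable C -> history Y k (Y i @^-1` C).
Proof.
move=> ik mC; apply: sub_sigma_algebra; exists i => //; exists C => //.
by rewrite setTI.
Qed.

Lemma history_measurable k A : history Y k A -> measurable A.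
Proof.
apply: smallest_sub; first exact: sigma_algebra_measurable.
move=> C [i _ [D mD <-]]; rewrite setTI.
by rewrite -[_ @^-1` _]setTI; exact: measurable_funP.
Qed.

Lemma history_le j k A : (j <= k)%N -> history Y j A -> history Y k A.
Proof.
move=> jk; apply: smallest_sub; first exact: smallest_sigma_algebra.
move=> C [i /= ij [D mD <-]]; rewrite setTI; apply: history_obs => //.
exact: leq_trans ij jk.
Qed.

Lemma history_score k (C : set R) : measurable C -> history Y k (score k @^-1` C).
Proof.
pose G := \bigcup_(i < k) preimage_set_system setT (Y i) (measurable : set (set R)).
have mscore : measurable_fun (setT : set (g_sigma_algebraType G)) (score k).
  apply: measurable_funD => //; apply: measurable_sum => i.
  move=> _ D mD; rewrite setTI; exact: history_obs.
by move=> mC; have := mscore measurableT C mC; rewrite setTI.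
Qed.

Lemma measurable_score k : measurable_fun setT (score k).
Proof. by move=> _ C mC; rewrite setTI; apply: history_measurable; exact: history_score. Qed.

Definition rect k (C : nat -> set R) : set Omega := \bigcap_(i < k) (Y i @^-1` C i).

Lemma rectS k C : rect k.+1 C = rect k C `&` Y k @^-1` C k.
Proof.
apply/seteqP; split => [w rw|w [rw Yw] i /=].
  by split => [i /= ik|]; apply: rw => //=; exact: ltnW.
by rewrite ltnS leq_eqVlt => /predU1P[->//|]; exact: rw.
Qed.

Lemma rect_update k C D : rect k (fun i => if i == k then D else C i) = rect k C.
Proof. by apply: eq_bigcapr => i /= /ltn_eqF ->. Qed.

Lemma rect0 C : rect 0 C = setT.
Proof. by apply/seteqP; split => // w _ i /=; rewrite ltn0. Qed.

Lemma history_rect k C : (forall i, measurable (C i)) -> history Y k (rect k C).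
Proof.
move=> mC; elim: k => [|k IH].
  by rewrite rect0; exact: historyT.
rewrite rectS; apply: historyI; first exact: history_le IH.
exact: history_obs.
Qed.

Lemma obs_law_mean u C : measurable C -> obs_law nu u C = obs_mean nu (\1_C) u.
Proof.
move=> mC; rewrite /obs_law integral_mkcond; apply: eq_integral => x _.
by rewrite patchE indicE; case: ifPn => _; rewrite ?mul1r ?mul0r.
Qed.

Lemma measurable_obs_indic C : measurable C -> measurable_fun setT (obs_mean nu (\1_C)).
Proof. by move=> mC; apply: measurable_obs_mean => //; exact: measurable_indic. Qed.

Definition posterior_mean (f : R -> \bar R) m y : \bar R :=
  (weight_mean nu mu f m y * ((mass setT m y)^-1)%:E)%E.

Lemma posterior_mean_ge0 f m y : (forall u, 0 <= f u)%E -> (0 <= posterior_mean f m y)%E.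
Proof. by move=> f0; rewrite mule_ge0 ?weight_mean_ge0// lee_fin invr_ge0. Qed.

Lemma measurable_inv_mass m : measurable_fun setT (fun y => (mass setT m y)^-1).
Proof.
rewrite (_ : (fun y => _) = expR \o (fun y => - ln (mass setT m y))); last first.
  by apply/funext => y /=; rewrite expRN lnK// posrE massT_gt0.
apply: measurableT_comp => //; apply: measurable_funN.
by apply: measurableT_comp => //; exact: measurable_mass.
Qed.

Lemma measurable_posterior_mean f m : measurable_fun setT f -> (forall u, 0 <= f u)%E ->
  measurable_fun setT (posterior_mean f m).
Proof.
move=> mf f0; apply: emeasurable_funM; first exact: measurable_weight_mean.
by apply/measurable_EFinP; exact: measurable_inv_mass.
Qed.

Lemma integral_distribution (f : R -> \bar R) : measurable_fun setT f -> (forall u, 0 <= f u)%E ->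
  (\int[distribution P Theta]_u f u = posterior_mean f n y0)%E.
Proof.
move=> mf f0.
have Tge : 0 <= (mass setT n y0)^-1 by rewrite invr_ge0.
pose g u := weight nu n y0 u * (mass setT n y0)^-1.
have mg : measurable_fun setT g by apply: measurable_funM => //; exact: measurable_weight.
have g0 u : 0 <= g u by rewrite mulr_ge0.
have dE A : measurable A -> distribution P Theta A = density mu g A.
  move=> mA; have [-> // _] := model; rewrite /mu_post /density.
  have -> : fine (weight_int nu mu n (y_of nu mu theta0 n pi0) (msupport mu)) = mass setT n y0.
    by rewrite -[msupport mu]setTI weight_int_msupport.
  under [RHS]eq_integral do rewrite EFinM.
  rewrite ge0_integralZr//.
  by move=> u _; rewrite lee_fin.
rewrite (integral_density mu g mg g0 _ _ dE mf f0) /posterior_mean weight_meanE.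
rewrite -ge0_integralZr//.
- by apply: eq_integral => u _; rewrite EFinM muleA.
- by apply: emeasurable_funM => //; exact: measurable_weightE.
- by move=> u _; rewrite mule_ge0 ?lee_fin.
Qed.

Lemma prod_obs_mean_ge0 k (C : nat -> set R) u :
  (0 <= \prod_(i < k) obs_mean nu (\1_(C i)) u)%E.
Proof. by apply: prode_ge0 => i _; exact: obs_mean_ge0. Qed.

Lemma measurable_prod_obs_mean k (C : nat -> set R) : (forall i, measurable (C i)) ->
  measurable_fun setT (fun u => \prod_(i < k) obs_mean nu (\1_(C i)) u)%E.
Proof.
move=> mC; elim: k => [|k IH].
  by rewrite (_ : (fun u => _) = cst 1%E)//; apply/funext => u; rewrite big_ord0.
rewrite (_ : (fun u => _) = (fun u => (\prod_(i < k) obs_mean nu (\1_(C i)) u) *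
  obs_mean nu (\1_(C k)) u)%E); last by apply/funext => u; rewrite big_ord_recr.
by apply: emeasurable_funM => //; exact: measurable_obs_indic.
Qed.

Lemma rect_prob k (C : nat -> set R) : (forall i, measurable (C i)) ->
  P (rect k C) = posterior_mean (fun u => \prod_(i < k) obs_mean nu (\1_(C i)) u)%E n y0.
Proof.
move=> mC; rewrite -integral_distribution; last 2 first.
- exact: measurable_prod_obs_mean.
- by move=> u; exact: prod_obs_mean_ge0.
have [_ /(_ k setT C measurableT mC)] := model.
rewrite preimage_setT setTI => ->; apply: eq_integral => u _.
by apply: eq_bigr => i _; rewrite obs_law_mean.
Qed.

Lemma weight_mean1 m y : weight_mean nu mu (fun=> 1%E) m y = (mass setT m y)%:E.
Proof. by rewrite massE// weight_meanE; apply: eq_integral => u _; rewrite mul1e. Qed.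

(* The mean of [phi] at the next observation, whose predictive density at the
   score [y] is [mass setT m.+1 (y + x) / mass setT m y]. *)
Definition step_mean (phi : R -> R) m y : \bar R :=
  (\int[nu]_x (phi x * (mass setT m.+1 (y + x) / mass setT m y))%:E)%E.

(** The predictive density is the posterior mixture of the densities [p nu u]. *)
Lemma step_meanE (phi : R -> R) m y : measurable_fun setT phi -> (forall x, 0 <= phi x) ->
  step_mean phi m y = posterior_mean (obs_mean nu phi) m y.
Proof.
move=> mphi phi0; rewrite /posterior_mean.
rewrite (_ : obs_mean nu phi = fun u => (1 * obs_mean nu phi u)%E); last first.
  by apply/funext => u; rewrite mul1e.
rewrite -(weight_meanS nu mu (fun=> 1%E) phi)// -ge0_integralZr//.
- by apply: eq_integral => x _; rewrite weight_mean1 -!EFinM mulrA.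
- apply: emeasurable_funM; first exact/measurable_EFinP.
  under eq_fun do rewrite weight_mean1.
  by apply/measurable_EFinP; exact: measurable_mass_shift.
- by move=> x _; rewrite weight_mean1 -EFinM lee_fin mulr_ge0.
- by rewrite lee_fin invr_ge0.
Qed.

Lemma step_mean_ge0 (phi : R -> R) m y : (forall x, 0 <= phi x) -> (0 <= step_mean phi m y)%E.
Proof. by move=> phi0; apply: integral_ge0 => x _; rewrite lee_fin mulr_ge0// divr_ge0. Qed.

Lemma step_mean_indic_fin C m y : measurable C -> step_mean \1_C m y \is a fin_num.
Proof.
move=> mC; have p0 x : 0 <= mass setT m.+1 (y + x) / mass setT m y by rewrite divr_ge0.
have mp : measurable_fun setT (fun x => mass setT m.+1 (y + x) / mass setT m y).
  by apply: measurable_funM => //; exact: measurable_mass_shift.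
rewrite ge0_fin_numE; last by apply: integral_ge0 => x _; rewrite lee_fin mulr_ge0.
apply: (@le_lt_trans _ _ (\int[nu]_x (mass setT m.+1 (y + x) / mass setT m y)%:E)%E).
  apply: ge0_le_integral => //.
  - by move=> x _; rewrite lee_fin mulr_ge0.
  - by apply/measurable_EFinP/measurable_funM => //; exact: measurable_indic.
  - exact/measurable_EFinP.
  - by move=> x _; rewrite lee_fin ler_piMl// indicE lern1 leq_b1.
under eq_integral do rewrite EFinM.
rewrite ge0_integralZr//.
- by rewrite mass_convolution1// -EFinM ltry.
- by apply/measurable_EFinP; exact: measurable_mass_shift.
- by move=> x _; rewrite lee_fin.
- by rewrite lee_fin invr_ge0.
Qed.

Lemma measurable_step_mean_indic C m : measurable C -> measurable_fun setT (step_mean \1_C m).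
Proof.
move=> mC; rewrite (_ : step_mean _ _ = posterior_mean (obs_mean nu \1_C) m).
  by apply: measurable_posterior_mean; [exact: measurable_obs_indic|move=> u; exact: obs_mean_ge0].
by apply/funext => y; rewrite step_meanE//; exact: measurable_indic.
Qed.

(* Averaging [f] over the prior times the likelihood of a rectangle of
   observations amounts to averaging its posterior mean over that rectangle. *)
Definition posterior_rect k := forall (f : R -> \bar R) (C : nat -> set R),
  measurable_fun setT f -> (forall u, 0 <= f u)%E ->
  (forall i, measurable (C i)) ->
  (posterior_mean (fun u => f u * \prod_(i < k) obs_mean nu (\1_(C i)) u) n y0 =
   \int[P]_(w in rect k C) posterior_mean f (n + k) (score k w))%E.

(** Conditionally on the first [k] observations, the next one has the predictive density with
    respect to [nu], so that the past matters only through the score. Integrating over all events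
    [G] of the history encodes the conditioning. *)
Definition step_law k := forall (G : set Omega) (H : R * R -> \bar R), history Y k G ->
  measurable_fun setT H -> (forall z, 0 <= H z)%E ->
  (\int[P]_(w in G) H (score k w, Y k w) =
   \int[P]_(w in G) \int[nu]_x (H (score k w, x) *
     (mass setT (n + k).+1 (score k w + x) / mass setT (n + k) (score k w))%:E))%E.

(** The event is a rectangle of [k.+1] observations; the factor of its last side takes the role of
    [f] in [posterior_rect k]. *)
Lemma step_law_rect k C D : posterior_rect k -> (forall i, measurable (C i)) -> measurable D ->
  (P (rect k C `&` Y k @^-1` D) =
   \int[P]_(w in rect k C) (fine (step_mean \1_D (n + k) (score k w)))%:E)%E.
Proof.
move=> Jk mC mD.
have mC' i : measurable (if i == k then D else C i) by case: ifP.
have := rect_prob k.+1 _ mC'.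
rewrite rectS rect_update eqxx => ->.
have -> : (fun u => \prod_(i < k.+1) obs_mean nu \1_(if i == k :> nat then D else C i) u)%E =
    (fun u => obs_mean nu \1_D u * \prod_(i < k) obs_mean nu \1_(C i) u)%E.
  apply/funext => u; rewrite big_ord_recr /= eqxx muleC; congr (_ * _)%E.
  by apply: eq_bigr => i _; rewrite (ltn_eqF (ltn_ord i)).
rewrite Jk//; [|exact: measurable_obs_indic|by move=> u; exact: obs_mean_ge0].
by apply: eq_integral => w _; rewrite fineK ?step_mean_indic_fin// step_meanE.
Qed.

(** Rectangles form a pi-system that generates the history. *)
Lemma step_law_history k G D : posterior_rect k -> history Y k G -> measurable D ->
  (P (G `&` Y k @^-1` D) =
   \int[P]_(w in G) (fine (step_mean \1_D (n + k) (score k w)))%:E)%E.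
Proof.
move=> Jk hG mD.
pose Rs := [set G | exists2 C, (forall i, measurable (C i)) & G = rect k C].
have mE : measurable (Y k @^-1` D) by rewrite -[_ @^-1` _]setTI; exact: measurable_funP.
apply: (integral_g_sigma_algebra P _ (fun w => fine (step_mean \1_D (n + k) (score k w))) Rs) => //.
- apply: measurableT_comp; first exact: fine_measurable.
  by apply: measurableT_comp; [exact: measurable_step_mean_indic|exact: measurable_score].
- by move=> w; rewrite fine_ge0// step_mean_ge0.
- by move=> _ [C mC ->]; apply: history_measurable; exact: history_rect.
- move=> _ _ [C mC ->] [C' mC' ->]; exists (fun i => C i `&` C' i).
    by move=> i; exact: measurableI.
  by rewrite /rect -bigcapI.
- exists (fun=> setT) => //; apply/esym/seteqP; split => // w _ i _ //.
- by move=> _ [C mC ->]; exact: step_law_rect.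
- move: G hG; apply: smallest_sub; first exact: smallest_sigma_algebra.
  move=> C [i /= ik [E mE' <-]]; rewrite setTI; apply: sub_sigma_algebra.
  exists (fun j => if j == i then E else setT); first by move=> j; case: ifP.
  apply/seteqP; split => [w Ew j _ /=|w]; first by case: eqP => // ->.
  by move=> /(_ i ik) /=; rewrite eqxx.
Qed.
Definition ratio m y x : R := mass setT m.+1 (y + x) / mass setT m y.

Lemma ratio_ge0 m y x : 0 <= ratio m y x.
Proof. by rewrite divr_ge0. Qed.

Lemma measurable_ratio k : measurable_fun setT
  (fun z : Omega * R => ratio (n + k) (score k z.1) z.2).
Proof.
have ms : measurable_fun setT (fun z : Omega * R => score k z.1).
  by apply: measurableT_comp; [exact: measurable_score|exact: measurable_fst].
apply: measurable_funM.
  apply: measurableT_comp; first exact: measurable_mass.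
  by apply: measurable_funD => //; exact: measurable_snd.
by apply: (measurableT_comp (measurable_inv_mass (n + k))).
Qed.

(** On [G], the joint law of [score k] and [Y k] is compared with the image of the product of [P]
    and [nu] under the predictive density; by [step_law_history] they agree on rectangles. *)
Lemma step_law_posterior k : posterior_rect k -> step_law k.
Proof.
move=> Jk G H hG mH H0; have mG := history_measurable _ _ hG.
have ms : measurable_fun setT (fun z : Omega * R => score k z.1).
  by apply: measurableT_comp; [exact: measurable_score|exact: measurable_fst].
pose f1 w := (score k w, Y k w).
pose f2 (z : Omega * R) := (score k z.1, z.2).
pose g1 : Omega -> R := \1_G.
pose g2 (z : Omega * R) : R := \1_G z.1 * ratio (n + k) (score k z.1) z.2.
have mf1 : measurable_fun setT f1.
  by apply/measurable_fun_pairP; split; [exact: measurable_score|exact: measurable_funP].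
have mf2 : measurable_fun setT f2.
  by apply/measurable_fun_pairP; split => //; exact: measurable_snd.
have mg1 : measurable_fun setT g1 by exact: measurable_indic.
have mg2 : measurable_fun setT g2.
  apply: measurable_funM; last exact: measurable_ratio.
  by apply: measurableT_comp; [exact: measurable_indic|exact: measurable_fst].
have g10 w : 0 <= g1 w by [].
have g20 z : 0 <= g2 z by rewrite mulr_ge0// ratio_ge0.
have fin1 : (\int[P]_w (g1 w)%:E < +oo)%E.
  by rewrite integral_indic// setIT (le_lt_trans (probability_le1 P mG))// ltry.
have := integral_density_prod_unique P (P \x nu)%E f1 f2 g1 g2 H mf1 mf2 mg1 mg2 g10 g20 fin1.
have rects A C : measurable A -> measurable C ->
    (\int[P]_(w in f1 @^-1` (A `*` C)) (g1 w)%:E =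
     \int[P \x nu]_(z in f2 @^-1` (A `*` C)) (g2 z)%:E)%E.
  move=> mA mC.
  have -> : f1 @^-1` (A `*` C) = score k @^-1` A `&` Y k @^-1` C by [].
  (* A condition on the current score belongs to the history, so it can be absorbed into [G]. *)
  have hGA : history Y k (G `&` score k @^-1` A).
    by apply: historyI => //; exact: history_score.
  have mYC : measurable (Y k @^-1` C) by rewrite -[_ @^-1` _]setTI; exact: measurable_funP.
  have msA : measurable (score k @^-1` A) by apply: history_measurable; exact: history_score.
  rewrite integral_indic//; last exact: measurableI.
  rewrite setIA; apply: etrans (step_law_history _ _ _ Jk hGA mC) _.
  rewrite integral_mul_indic.
  rewrite [RHS]integral_mul_indic.
  rewrite fubini_tonelli1 /=; last 2 first.
  - apply/measurable_EFinP/measurable_funM => //; apply: measurable_indic.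
    by rewrite -[_ @^-1` _]setTI; apply: mf2 => //; exact: measurableX.
  - by move=> z; rewrite lee_fin mulr_ge0.
  apply: eq_integral => w _; rewrite /fubini_F fineK ?step_mean_indic_fin//.
  rewrite /step_mean -ge0_integralZr//.
  - apply: eq_integral => x _; rewrite -!EFinM; congr (_%:E).
    rewrite /g2 /= -/(ratio (n + k) (score k w) x) !indicE in_setI.
    have -> : ((w, x) \in f2 @^-1` (A `*` C)) = (w \in score k @^-1` A) && (x \in C).
      by apply/idP/andP; rewrite !inE.
    by case: (w \in G); case: (w \in _ @^-1` _); case: (x \in C);
      rewrite /= ?(mul1r, mulr1, mul0r, mulr0).
  - apply/measurable_EFinP/measurable_funM; first exact: measurable_indic.
    by apply: measurable_funM => //; exact: measurable_mass_shift.
  - by move=> x _; rewrite lee_fin mulr_ge0// ratio_ge0.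
move=> /(_ rects mH H0) HH; rewrite [LHS]integral_mul_indic; apply: etrans HH _.
rewrite fubini_tonelli1 /=; last 2 first.
- apply: emeasurable_funM; last exact/measurable_EFinP.
  exact: measurableT_comp.
- by move=> z; rewrite mule_ge0// lee_fin.
rewrite [RHS]integral_mul_indic; apply: eq_integral => w _; rewrite /fubini_F.
rewrite -ge0_integralZr//.
- by apply: eq_integral => x _; rewrite /g2 /= mulrC EFinM muleA.
- apply: emeasurable_funM.
    exact: (measurableT_comp mH (measurable_pair1 (score k w))).
  apply/measurable_EFinP.
  by apply: measurable_funM => //; exact: measurable_mass_shift.
- by move=> x _; rewrite mule_ge0// lee_fin ratio_ge0.
Qed.

(** The two properties are proved alternately: [posterior_rect k] gives [step_law k], which gives
    [posterior_rect k.+1] after the factor of the last side has been moved into [f]. *)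
Lemma posterior_rect_all k : posterior_rect k.
Proof.
elim: k => [|k Jk] f C mf f0 mC.
  rewrite rect0.
  under [RHS]eq_integral do rewrite score0 addn0.
  rewrite [RHS](integral_cst P measurableT) [X in (_ * X)%E](_ : _ = 1%E);
    last exact: probability_setT.
  rewrite mule1; congr (posterior_mean _ _ _).
  by apply/funext => u; rewrite big_ord0 mule1.
have mo i : measurable_fun setT (obs_mean nu \1_(C i)) by exact: measurable_obs_indic.
have -> : (fun u => f u * \prod_(i < k.+1) obs_mean nu \1_(C i) u)%E =
    (fun u => (f u * obs_mean nu \1_(C k) u) * \prod_(i < k) obs_mean nu \1_(C i) u)%E.
  by apply/funext => u; rewrite big_ord_recr /= [X in (_ * X)%E]muleC muleA.
have fo0 u : (0 <= f u * obs_mean nu \1_(C k) u)%E by rewrite mule_ge0 ?obs_mean_ge0.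
have mfo : measurable_fun setT (fun u => f u * obs_mean nu \1_(C k) u)%E by exact: emeasurable_funM.
apply: etrans (Jk _ C mfo fo0 mC) _.
pose H (z : R * R) : \bar R :=
  ((\1_(C k) z.2)%:E * posterior_mean f (n + k).+1 (z.1 + z.2))%E.
have H0 z : (0 <= H z)%E by rewrite mule_ge0 ?posterior_mean_ge0// lee_fin.
have mH : measurable_fun setT H.
  apply: emeasurable_funM.
    apply/measurable_EFinP; apply: measurableT_comp; first exact: measurable_indic.
    exact: measurable_snd.
  apply: measurableT_comp; first exact: measurable_posterior_mean.
  by apply: measurable_funD; [exact: measurable_fst|exact: measurable_snd].
have := step_law_posterior k Jk _ _ (history_rect k C mC) mH H0.
have -> : (\int[P]_(w in rect k C) H (score k w, Y k w) =
    \int[P]_(w in rect k.+1 C) posterior_mean f (n + k.+1) (score k.+1 w))%E.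
  rewrite integral_mul_indic [RHS]integral_mul_indic; apply: eq_integral => w _.
  rewrite /H /= scoreS addnS rectS !indicE in_setI.
  have -> : (w \in Y k @^-1` C k) = (Y k w \in C k) by apply/idP/idP; rewrite !inE.
  by case: (w \in rect k C); case: (_ \in C k); rewrite /= ?(mul1e, mule1, mul0e, mule0).
move=> ->; apply: eq_integral => w _.
(* Read backwards, [weight_meanS] turns the factor of the last side into an integral over the next
   observation; the mass at the new score cancels between the updated posterior mean and the
   predictive density. *)
rewrite {1}/posterior_mean -weight_meanS// -ge0_integralZr//.
- apply: eq_integral => x _; rewrite /H /= /posterior_mean -!muleA; congr (_ * (_ * _))%E.
  by rewrite -EFinM mulrA mulVf ?mul1r// gt_eqF// massT_gt0.
- apply: emeasurable_funM; first exact/measurable_EFinP/measurable_indic.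
  by apply: measurableT_comp; [exact: measurable_weight_mean|exact: measurable_funD].
- by move=> x _; rewrite mule_ge0 ?weight_mean_ge0// lee_fin.
- by rewrite lee_fin invr_ge0.
Qed.

Lemma step_law_all k : step_law k.
Proof. by apply: step_law_posterior; exact: posterior_rect_all. Qed.

(** The numerator of the predictive density cancels the normalization of [h], which explains the
    plain integral against [nu] in the recursion for [value]. *)
Lemma step_score (h : R -> R) k G : history Y k G -> measurable_fun setT h -> (forall y, 0 <= h y) ->
  (\int[P]_(w in G) (h (score k.+1 w) / mass setT (n + k).+1 (score k.+1 w))%:E =
   \int[P]_(w in G) ((\int[nu]_x (h (score k w + x))%:E) *
     ((mass setT (n + k) (score k w))^-1)%:E))%E.
Proof.
move=> hG mh h0.
pose H (z : R * R) : \bar R := (h (z.1 + z.2) / mass setT (n + k).+1 (z.1 + z.2))%:E.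
have H0 z : (0 <= H z)%E by rewrite lee_fin divr_ge0.
have mD : measurable_fun setT (fun z : R * R => z.1 + z.2).
  by apply: measurable_funD; [exact: measurable_fst|exact: measurable_snd].
have mH : measurable_fun setT H.
  apply/measurable_EFinP/measurable_funM; first exact: measurableT_comp.
  exact: (measurableT_comp (measurable_inv_mass (n + k).+1) mD).
have := step_law_all _ _ _ hG mH H0.
under eq_integral do rewrite /H /= -scoreS.
move=> ->; apply: eq_integral => w _.
rewrite -ge0_integralZr//.
- apply: eq_integral => x _; rewrite /H /= -!EFinM; congr (_%:E).
  by field; rewrite !gt_eqF// massT_gt0.
- by apply/measurable_EFinP; apply: measurableT_comp => //; exact: measurable_funD.
- by move=> x _; rewrite lee_fin.
- by rewrite lee_fin invr_ge0.
Qed.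
(** * Optimal stopping *)

Lemma stop_valueE m y : stop_value m y / mass setT m y =
  Num.min (q nu mu theta0 m y) (1 - q nu mu theta0 m y).
Proof.
rewrite /stop_value upper_q lower_q; have T0 := massT_gt0 m y.
by rewrite -minr_pMl ?ltW// mulfK// gt_eqF.
Qed.

Lemma measurable_stopped (h : nat -> Omega -> R) (tau : Omega -> nat) :
  (forall k, measurable [set w | (tau w <= k)%N]) ->
  (forall k, measurable_fun setT (h k)) -> measurable_fun setT (fun w => h (tau w) w).
Proof.
move=> mtau mh _ D mD; rewrite setTI.
have meq k : measurable [set w | tau w = k].
  case: k => [|k].
    rewrite (_ : [set w | _] = [set w | (tau w <= 0)%N])//.
    by apply/seteqP; split => w /=; rewrite leqn0 => /eqP.
  rewrite (_ : [set w | _] = [set w | (tau w <= k.+1)%N] `\` [set w | (tau w <= k)%N]).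
    exact: measurableD.
  apply/seteqP; split => w /=; first by move=> ->; split => //; rewrite ltnn.
  by move=> [h1 /negP h2]; apply/eqP; rewrite eqn_leq h1 ltnNge h2.
rewrite (_ : _ @^-1` D = \bigcup_k ([set w | tau w = k] `&` h k @^-1` D)).
  apply: bigcupT_measurable => k; apply: measurableI => //.
  by rewrite -[_ @^-1` _]setTI; exact: mh.
apply/seteqP; split => w /=; first by move=> hw; exists (tau w).
by move=> [k _ [/= <- hw]].
Qed.

Definition loss (tau : Omega -> nat) w : R := Num.min (Pi nu mu theta0 X n pi0 (tau w) w)
  (1 - Pi nu mu theta0 X n pi0 (tau w) w) + c * (tau w)%:R.

Lemma riskE tau : risk nu mu theta0 X c n pi0 P tau = (\int[P]_w (loss tau w)%:E)%E.
Proof. by rewrite /risk unlock. Qed.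

Lemma lossE tau w : loss tau w = stop_value (n + tau w) (score (tau w) w) /
  mass setT (n + tau w) (score (tau w) w) + c * (tau w)%:R.
Proof. by rewrite stop_valueE. Qed.

Lemma loss_ge0 tau w : 0 <= loss tau w.
Proof. by rewrite lossE addr_ge0 ?divr_ge0 ?stop_value_ge0// mulr_ge0. Qed.

Lemma risk_ge0 tau : (0 <= risk nu mu theta0 X c n pi0 P tau)%E.
Proof. by rewrite riskE; apply: integral_ge0 => w _; rewrite lee_fin loss_ge0. Qed.

(** * Lower bound for the risk of an arbitrary stopping time *)

Section truncated_problem.
Variable N : nat.

(* The optimal conditional cost, given the first [k] observations, of the
   problem truncated after [N] observations. *)
Definition stage k w : R :=
  value (N - k) (n + k) (score k w) / mass setT (n + k) (score k w) + c * k%:R.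

(** The same cost when at least one more observation is taken after the first [k]. *)
Definition cont k w : R :=
  fine (\int[nu]_x (value (N - k.+1) (n + k).+1 (score k w + x))%:E)%E /
    mass setT (n + k) (score k w) + c * k.+1%:R.

Lemma stage_ge0 k w : 0 <= stage k w.
Proof. by rewrite addr_ge0 ?divr_ge0 ?value_ge0// mulr_ge0. Qed.

Lemma measurable_stage k : measurable_fun setT (stage k).
Proof.
apply: measurable_funD => //; apply: measurable_funM.
  exact: (measurableT_comp (measurable_value _ _) (measurable_score k)).
exact: (measurableT_comp (measurable_inv_mass (n + k)) (measurable_score k)).
Qed.

Lemma measurable_next_value k : measurable_fun setT (fun w =>
  \int[nu]_x (value (N - k.+1) (n + k).+1 (score k w + x))%:E)%E.
Proof.
apply: (measurableT_comp (measurable_shift_mean _ _ _) (measurable_score k)).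
  exact: measurable_value.
by move=> y; exact: value_ge0.
Qed.

Lemma measurable_inv_mass_score k :
  measurable_fun setT (fun w => (mass setT (n + k) (score k w))^-1).
Proof. exact: (measurableT_comp (measurable_inv_mass (n + k)) (measurable_score k)). Qed.

Lemma measurable_cont k : measurable_fun setT (cont k).
Proof.
apply: measurable_funD => //; apply: measurable_funM; last exact: measurable_inv_mass_score.
by apply: measurableT_comp; [exact: fine_measurable|exact: measurable_next_value].
Qed.

Lemma stageE k w : (k < N)%N ->
  stage k w = Num.min (stop_value (n + k) (score k w) / mass setT (n + k) (score k w) + c * k%:R)
    (cont k w).
Proof.
move=> kN; rewrite /stage /cont -(subnSK kN) valueS.
set S := stop_value _ _; set I := fine _; have T0 := massT_gt0 (n + k) (score k w).
move: (mass _ _ _) T0 => T T0.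
rewrite minr_pMl ?invr_ge0 ?ltW// addr_minl; congr Num.min.
by rewrite -natr1; field; rewrite gt_eqF.
Qed.

(** [cont k] is the conditional expectation of [stage k.+1] given the first [k] observations. *)
Lemma integral_stageS k G : (k < N)%N -> history Y k G ->
  (\int[P]_(w in G) (stage k.+1 w)%:E = \int[P]_(w in G) (cont k w)%:E)%E.
Proof.
move=> kN hG; have mG := history_measurable _ _ hG.
have mv : measurable_fun setT (value (N - k.+1) (n + k).+1) by exact: measurable_value.
have ck0 : 0 <= c * k.+1%:R by rewrite mulr_ge0.
have := integral_eq_addr P G _ _ (c * k.+1%:R) mG _ _ _ _ ck0
  (step_score _ k G hG mv (value_ge0 _ _)).
have -> : (\int[P]_(w in G) (stage k.+1 w)%:E = \int[P]_(w in G)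
    ((value (N - k.+1) (n + k).+1 (score k.+1 w) / mass setT (n + k).+1 (score k.+1 w))%:E +
     (c * k.+1%:R)%:E))%E.
  by apply: eq_integral => w _; rewrite /stage addnS EFinD.
have -> : (\int[P]_(w in G) (cont k w)%:E = \int[P]_(w in G)
    ((\int[nu]_x (value (N - k.+1) (n + k).+1 (score k w + x))%:E) *
      ((mass setT (n + k) (score k w))^-1)%:E + (c * k.+1%:R)%:E))%E.
  apply: eq_integral => w _; rewrite /cont EFinD EFinM fineK//.
  exact: value_integral_fin.
apply.
- apply/measurable_EFinP/measurable_funTS/measurable_funM.
    exact: (measurableT_comp (measurable_value _ _) (measurable_score k.+1)).
  by have := measurable_inv_mass_score k.+1; rewrite addnS.
- apply/measurable_funTS/emeasurable_funM; first exact: measurable_next_value.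
  by apply/measurable_EFinP; exact: measurable_inv_mass_score.
- by move=> w; rewrite lee_fin divr_ge0 ?value_ge0.
- move=> w; rewrite mule_ge0 ?lee_fin ?invr_ge0//.
  by apply: integral_ge0 => x _; rewrite lee_fin value_ge0.
Qed.

Variable tau : Omega -> nat.
Hypothesis tau_stop : stopping_time (history Y) tau.

Let mtau k : measurable [set w | (tau w <= k)%N].
Proof. exact: history_measurable (tau_stop k). Qed.

Let hgt k : history Y k [set w | (k < tau w)%N].
Proof.
rewrite (_ : [set w | _] = ~` [set w | (tau w <= k)%N]).
  by apply: historyC; exact: tau_stop.
by apply/seteqP; split => w /=; rewrite ltnNge => /negP.
Qed.

Definition stopped_cost k : \bar R := (\int[P]_w (stage (minn (tau w) k) w)%:E)%E.

Let stage_min0 k (w : Omega) : (0 <= (stage (minn (tau w) k) w)%:E)%E.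
Proof. by rewrite lee_fin stage_ge0. Qed.

Let mstage_min k : measurable_fun setT (fun w => (stage (minn (tau w) k) w)%:E).
Proof.
apply/measurable_EFinP; apply: (measurable_stopped (fun j => stage (minn j k))) => // j.
exact: measurable_stage.
Qed.

(** On [tau <= j] the stopped process no longer changes after time [j]; letting [k] be [j] or [j.+1]
    splits two consecutive costs over the same two events. *)
Lemma stopped_costE k j : (j <= k <= j.+1)%N -> stopped_cost k =
  (\int[P]_(w in [set w | (tau w <= j)%N]) (stage (tau w) w)%:E +
   \int[P]_(w in [set w | (j < tau w)%N]) (stage k w)%:E)%E.
Proof.
move=> /andP[jk kj].
have mgt : measurable [set w | (j < tau w)%N] by exact: history_measurable (hgt j).
have U : [set w | (tau w <= j)%N] `|` [set w | (j < tau w)%N] = setT.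
  by apply/seteqP; split => w //= _; apply/orP; case: leqP.
rewrite /stopped_cost -U ge0_integral_setU//.
- congr (_ + _)%E; apply: eq_integral => w /[!inE] /= tw.
    by rewrite (minn_idPl _)// (leq_trans tw).
  by rewrite (minn_idPr _)// (leq_trans kj).
- by rewrite U.
- rewrite disj_set2E; apply/eqP/seteqP; split => w //= [h1].
  by rewrite ltnNge h1.
Qed.

(** The process [stage] is a submartingale up to time [N], since [stage k <= cont k], and stopping
    preserves this. *)
Lemma stopped_cost_le k : (k < N)%N -> (stopped_cost k <= stopped_cost k.+1)%E.
Proof.
move=> kN; rewrite (stopped_costE k k) ?leqnn ?leqnSn// (stopped_costE k.+1 k) ?leqnn ?leqnSn//.
apply: leeD => //; rewrite (integral_stageS k _ kN (hgt k)).
have mgt : measurable [set w | (k < tau w)%N] by exact: history_measurable (hgt k).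
apply: ge0_le_integral => //.
- by move=> w _; rewrite lee_fin stage_ge0.
- by apply/measurable_EFinP/measurable_funTS; exact: measurable_stage.
- by apply/measurable_EFinP/measurable_funTS; exact: measurable_cont.
- by move=> w _; rewrite lee_fin stageE// ge_min lexx orbT.
Qed.

Lemma stopped_cost_eq k : (k < N)%N ->
  (forall w, (k < tau w)%N -> stage k w = cont k w) ->
  stopped_cost k = stopped_cost k.+1.
Proof.
move=> kN opt; rewrite (stopped_costE k k) ?leqnn ?leqnSn// (stopped_costE k.+1 k) ?leqnn ?leqnSn//.
congr (_ + _)%E; rewrite (integral_stageS k _ kN (hgt k)); apply: eq_integral => w /[!inE] /= kw.
by rewrite opt.
Qed.

Lemma stopped_cost0 : stopped_cost 0 = (bounded_risk N n pi0)%:E.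
Proof.
rewrite /stopped_cost.
under eq_integral do rewrite minn0 /stage score0 subn0 addn0 mulr0 addr0.
rewrite [LHS](integral_cst P measurableT) [X in (_ * X)%E](_ : _ = 1%E) ?mule1//.
exact: probability_setT.
Qed.

Lemma measurable_loss : measurable_fun setT (loss tau).
Proof.
rewrite (_ : loss tau = fun w => (fun k w => stop_value (n + k) (score k w) /
  mass setT (n + k) (score k w) + c * k%:R) (tau w) w); last by apply/funext => w; rewrite lossE.
apply: (measurable_stopped (fun k w => stop_value (n + k) (score k w) /
  mass setT (n + k) (score k w) + c * k%:R)) => // k.
apply: measurable_funD => //; apply: measurable_funM.
  by apply: measurableT_comp; [exact: measurable_stop_value|exact: measurable_score].
by apply: (measurableT_comp (measurable_inv_mass (n + k))); exact: measurable_score.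
Qed.

(** When the rule is cut off at [N], the forced decision costs at most 1, charged to the indicator,
    and the observation cost only drops. *)
Lemma stage_le_loss w : stage (minn (tau w) N) w <= loss tau w + \1_[set w | (N < tau w)%N] w.
Proof.
rewrite lossE indicE; have [tN|Nt] := leqP (tau w) N.
  rewrite memNset /= ?addr0; last by rewrite ltnNge tN.
  rewrite lerD2r ler_pM2r ?invr_gt0 ?massT_gt0//.
  by case/andP: (value_bounds (N - tau w) (n + tau w) (score (tau w) w)).
rewrite mem_set//= /stage subnn /=.
rewrite addrAC lerD//; last by rewrite ler_wpM2l// ler_nat ltnW.
rewrite ler_wpDl ?divr_ge0 ?stop_value_ge0//.
rewrite ler_pdivrMr ?massT_gt0// mul1r massT /stop_value.
by rewrite ge_min lerDl mass_ge0.
Qed.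

Lemma bounded_risk_le : ((bounded_risk N n pi0)%:E <=
  risk nu mu theta0 X c n pi0 P tau + P [set w | (N < tau w)%N])%E.
Proof.
have mgt : measurable [set w | (N < tau w)%N] by exact: history_measurable (hgt N).
rewrite -stopped_cost0.
have le0 k : (k <= N)%N -> (stopped_cost 0 <= stopped_cost k)%E.
  elim: k => [//|k IH kN]; apply: le_trans (IH (ltnW kN)) _; exact: stopped_cost_le.
apply: le_trans (le0 N (leqnn N)) _; rewrite riskE.
rewrite [X in (_ <= _ + X)%E](_ : _ = \int[P]_w (\1_[set w | (N < tau w)%N] w)%:E)%E; last first.
  by rewrite integral_indic// setIT.
have m1 : measurable_fun setT (fun w => (\1_[set w | (N < tau w)%N] w)%:E : \bar R).
  by apply/measurable_EFinP; exact: measurable_indic.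
have ml : measurable_fun setT (fun w => (loss tau w)%:E).
  by apply/measurable_EFinP; exact: measurable_loss.
rewrite -ge0_integralD//; last by move=> w _; rewrite lee_fin loss_ge0.
apply: ge0_le_integral => //.
- exact: emeasurable_funD.
- by move=> w _; rewrite -EFinD lee_fin stage_le_loss.
Qed.

End truncated_problem.
(** Stop as soon as the value equals the stopping value, at the latest after [N] observations.
    Before that time continuing attains the minimum, so the stopped cost stays constant. *)
Lemma optimal_stopping_time N : exists2 tau, stopping_time (history Y) tau &
  risk nu mu theta0 X c n pi0 P tau = (bounded_risk N n pi0)%:E.
Proof.
pose stop k w := value (N - k) (n + k) (score k w) == stop_value (n + k) (score k w).
have stopN w : exists k, stop k w by exists N; rewrite /stop subnn.
pose tau w := ex_minn (stopN w).
have tauP w : stop (tau w) w by rewrite /tau; case: ex_minnP.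
have tau_min w k : stop k w -> (tau w <= k)%N by rewrite /tau; case: ex_minnP => m _; exact.
have tauN w : (tau w <= N)%N by apply: tau_min; rewrite /stop subnn.
have tau_stop : stopping_time (history Y) tau.
  move=> k.
  rewrite (_ : [set w | _] = \bigcup_(j < k.+1) [set w | stop j w]); last first.
    apply/seteqP; split => w /=; first by move=> tk; exists (tau w) => //; exact: tauP.
    by move=> [j /= jk sj]; apply: leq_trans (tau_min _ _ sj) _.
  apply: (@bigcup_measurable _ (g_sigma_algebraType _)) => j /= jk.
  apply: (history_le j k) => //.
  pose D := [set y | value (N - j) (n + j) y - stop_value (n + j) y = 0].
  rewrite (_ : [set w | _] = score j @^-1` D).
    apply: history_score.
    have mf : measurable_fun setT (fun y => value (N - j) (n + j) y - stop_value (n + j) y).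
      by apply: measurable_funB; [exact: measurable_value|exact: measurable_stop_value].
    by have := mf measurableT _ (measurable_set1 0); rewrite setTI.
  apply/seteqP; split => w; rewrite /stop /D /=.
    by move=> /eqP ->; rewrite subrr.
  by move=> /eqP; rewrite subr_eq0.
exists tau => //; rewrite riskE -(stopped_cost0 N tau).
have cont_eq k w : (k < N)%N -> (k < tau w)%N -> stage N k w = cont N k w.
  move=> kN ktau; have := stageE N k w kN.
  (* If the minimum were the stopping cost, [tau] would be at most [k]. *)
  rewrite minElt; case: ifP => // _ /addIr/(divIf (lt0r_neq0 (massT_gt0 _ _))) e.
  by have := tau_min w k; rewrite /stop e eqxx leqNgt ktau => /(_ isT).
have cost_eq k : (k <= N)%N -> stopped_cost N tau k = stopped_cost N tau 0.
  elim: k => [//|k IH kN]; rewrite -IH ?(ltnW kN)//; apply/esym/stopped_cost_eq => // w.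
  exact: cont_eq.
rewrite -(cost_eq N)//; apply: eq_integral => w _.
by rewrite (minn_idPl (tauN w)) lossE /stage (eqP (tauP w)).
Qed.

Let risks := [set risk nu mu theta0 X c n pi0 P tau | tau in
  [set tau | stopping_time (history (fun i => X (n + i).+1)) tau]].

Lemma inf_risk_le N : (ereal_inf risks <= (bounded_risk N n pi0)%:E)%E.
Proof.
have [tau st rE] := optimal_stopping_time N.
by apply: ereal_inf_lbound; exists tau.
Qed.

Lemma inf_risk_fin : ereal_inf risks \is a fin_num.
Proof.
rewrite ge0_fin_numE; first by rewrite (le_lt_trans (inf_risk_le 0))// ltry.
by apply: le_ereal_inf_tmp => _ [tau _ <-]; exact: risk_ge0.
Qed.

Lemma fine_inf_risk_le N : fine (ereal_inf risks) <= bounded_risk N n pi0.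
Proof. by rewrite -lee_fin fineK ?inf_risk_fin// inf_risk_le. Qed.

(** Half of [e] pays for a nearly optimal [tau], the other half for its truncation: the events
    [k < tau] decrease to the empty set. *)
Lemma fine_inf_risk_adherent e : 0 < e ->
  exists N, bounded_risk N n pi0 <= fine (ereal_inf risks) + e.
Proof.
move=> e0; have e20 : 0 < e / 2 by rewrite divr_gt0.
have [_ [tau st <-] rlt] := lb_ereal_inf_adherent e20 inf_risk_fin.
pose F k := [set w | (k < tau w)%N].
have mF k : measurable (F k).
  rewrite (_ : F k = ~` [set w | (tau w <= k)%N]).
    by apply: measurableC; exact: history_measurable (st k).
  by apply/seteqP; split => w /=; rewrite /F /= ltnNge => /negP.
have F0 : \bigcap_k F k = set0.
  by apply/seteqP; split => // w /(_ (tau w) I); rewrite /F /= ltnn.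
have cv : P \o F @ \oo --> (0%E : \bar R).
  rewrite -(measure0 P) -F0; apply: nonincreasing_cvg_mu => //.
  - by rewrite (le_lt_trans (probability_le1 P (mF 0%N)))// ltry.
  - by rewrite F0.
  - by move=> i j ij; apply/subsetPset => w /=; exact: leq_ltn_trans.
have [N _ HN] : \forall N \near \oo, (P (F N) < (e / 2)%:E)%E.
  have e2 : (0%E < (e / 2)%:E)%E by rewrite lte_fin.
  exact: cv (open_ereal_lt' e2).
exists N; rewrite -lee_fin; apply: le_trans (bounded_risk_le N tau st) _.
rewrite EFinD fineK ?inf_risk_fin// [X in (_ <= _ + X%:E)%E](splitr e) EFinD addeA.
by apply: leeD; apply: ltW => //; exact: (HN N (leqnn N)).
Qed.

End observations.

End bayes_weights.

Theorem theorem3p3 (R : realType)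
  (nu : {sigma_finite_measure set R -> \bar R})
  (mu : probability R R) (theta0 c : R)
  (d : measure_display) (Omega : measurableType d)
  (Theta : {mfun Omega >-> R}) (X : nat -> {mfun Omega >-> R})
  (P : nat -> R -> probability Omega R)
  (nu_neq0 : nu setT <> 0%E)
  (mu_concentrated : mu (interior (Ndom nu)) = 1%E)
  (mu_Splus : (0 < mu (Splus mu theta0) < 1)%E)
  (weight_fin : forall (n : nat) (y : R),
     (weight_int nu mu n y (msupport mu) < +oo)%E)
  (c_gt0 : 0 < c)
  (P_model : forall (n : nat) (pi0 : R), 0 < pi0 < 1 ->
     bayes_model nu mu theta0 Theta X n pi0 (P n pi0)) :
  forall n : nat,
    concave_function (`]0, 1[ : set R) (V nu mu theta0 X c P n).
Proof.
move=> n t x y; rewrite !inE /= !in_itv /= => x01 y01.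
pose s : R := t%:num.
have s01 : 0 <= s <= 1 by rewrite /s ge0 le1.
suff : s * V nu mu theta0 X c P n x + (1 - s) * V nu mu theta0 X c P n y <=
    V nu mu theta0 X c P n (s * x + (1 - s) * y) by [].
have z01 := convex_combination_in01 _ _ _ s01 x01 y01.
have V_le z : 0 < z < 1 -> forall N, V nu mu theta0 X c P n z <= bounded_risk nu mu theta0 c N n z.
  move=> hz N; exact: (fine_inf_risk_le nu mu theta0 nu_neq0 mu_concentrated mu_Splus
    weight_fin c (ltW c_gt0) Theta X n z (P n z) (P_model n z hz)).
apply/ler_addgt0Pr => e e0.
(* The level [N] is chosen for the combined point alone: at [x] and [y] the value lies below the
   truncated risk for every [N]. *)
have [N HN] := fine_inf_risk_adherent nu mu theta0 nu_neq0 mu_concentrated mu_Splus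
  weight_fin c (ltW c_gt0) Theta X n _ (P n _) (P_model n _ z01) e e0.
apply: le_trans HN.
apply: le_trans (bounded_risk_concave nu mu theta0 nu_neq0 mu_concentrated mu_Splus
  weight_fin c (ltW c_gt0) N n s x y s01 x01 y01).
have /andP[s0 s1] := s01.
by rewrite lerD// ler_wpM2l ?subr_ge0// V_le.
Qed.
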